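(* Let $\Gamma$ be an austere graph with vertex set $V$, and suppose $n=|V|>1$. Then $|\mathrm{Out}(\mathrm{Aut}(A_\Gamma))|\geq 2^n$.
   Context: Graphs are finite and simplicial. For a graph $\Gamma$ with vertex set $V$, the right-angled Artin group $A_\Gamma$ is the group with generating set $V$ and relations $uv=vu$ for each pair of adjacent vertices $u,v$. For $v\in V$, the link $\mathrm{lk}(v)$ is the set of vertices adjacent to $v$, and the star is $\mathrm{st}(v)=\mathrm{lk}(v)\cup\{v\}$. A vertex $u$ dominates a vertex $v$ if $\mathrm{lk}(v)\subseteq \mathrm{st}(u)$. A graph $\Gamma$ is austere if it has trivial graph automorphism group, no dominated vertices (i.e. there are no distinct vertices $u\neq v$ with $\mathrm{lk}(v)\subseteq\mathrm{st}(u)$), and for every $v\in V$ the induced subgraph $\Gamma\setminus\mathrm{st}(v)$ on $V\setminus \mathrm{st}(v)$ is connected. For a group $G$, $\mathrm{Out}(G)=\mathrm{Aut}(G)/\mathrm{Inn}(G)$. *)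

(* Defs.v *)
From HB Require Import structures.
From mathcomp Require Import all_boot.
From mathcomp Require Import boolp classical_sets functions cardinality.

Set Implicit Arguments.
Unset Strict Implicit.
Unset Printing Implicit Defensive.

Local Open Scope quotient_scope.
Local Open Scope group_scope.

Record normalSubgroup (G : groupType) := NormalSubgroup {
  nsub_set :> G -> Prop;
  nsub1 : nsub_set 1;
  nsubM : forall x y, nsub_set x -> nsub_set y -> nsub_set (x * y);
  nsubV : forall x, nsub_set x -> nsub_set x^-1;
  nsubJ : forall x y, nsub_set x -> nsub_set (x ^ y)
}.

Section QuotientGroup.
Variables (G : groupType) (N : normalSubgroup G).

Definition coset_rel : rel G := fun x y => `[< N (x^-1 * y) >].

Lemma coset_relP x y : reflect (N (x^-1 * y)) (coset_rel x y).
Proof. exact: asboolP. Qed.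

Lemma coset_rel_refl : reflexive coset_rel.
Proof. by move=> x; apply/coset_relP; rewrite mulVg; apply: nsub1. Qed.

Lemma coset_rel_sym : symmetric coset_rel.
Proof.
suff H x y : coset_rel x y -> coset_rel y x by move=> x y; apply/idP/idP; apply: H.
by move=> /coset_relP/nsubV; rewrite invgM invgK => ?; apply/coset_relP.
Qed.

Lemma coset_rel_trans : transitive coset_rel.
Proof.
move=> y x z /coset_relP xy /coset_relP yz; apply/coset_relP.
by have := nsubM xy yz; rewrite mulgA mulgK.
Qed.

Canonical coset_equiv :=
  EquivRel coset_rel coset_rel_refl coset_rel_sym coset_rel_trans.

Definition quotient_group := {eq_quot coset_equiv}.

HB.instance Definition _ := Choice.on quotient_group.

Definition quotient_pi (x : G) : quotient_group := \pi_quotient_group x.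

Lemma quotient_piP x y : quotient_pi x = quotient_pi y <-> N (x^-1 * y).
Proof.
split; first by move=> /eqmodP/coset_relP.
by move=> xy; apply/eqmodP/coset_relP.
Qed.

Lemma quotient_reprK (a : quotient_group) : quotient_pi (repr a) = a.
Proof. exact: reprK. Qed.

Definition quotient_one := quotient_pi 1.
Definition quotient_inv (a : quotient_group) := quotient_pi (repr a)^-1.
Definition quotient_mul (a b : quotient_group) := quotient_pi (repr a * repr b).

Lemma quotient_mulE x y :
  quotient_mul (quotient_pi x) (quotient_pi y) = quotient_pi (x * y).
Proof.
apply/quotient_piP; set x' := repr _; set y' := repr _.
have /quotient_piP/(nsubJ y) Nx : quotient_pi x' = quotient_pi x.
  exact: quotient_reprK.
have /quotient_piP Ny : quotient_pi y' = quotient_pi y by exact: quotient_reprK.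
have := nsubM Ny Nx.
by rewrite /conjg invgM !mulgA mulgK.
Qed.

Lemma quotient_invE x : quotient_inv (quotient_pi x) = quotient_pi x^-1.
Proof.
apply/quotient_piP; set x' := repr _.
have /quotient_piP/nsubV/(nsubJ x^-1) : quotient_pi x' = quotient_pi x.
  exact: quotient_reprK.
by rewrite /conjg !invgM !invgK !mulgA mulgV mul1g.
Qed.

Lemma quotient_mulA : associative quotient_mul.
Proof.
move=> a b c; rewrite -[a]quotient_reprK -[b]quotient_reprK -[c]quotient_reprK.
by rewrite !quotient_mulE mulgA.
Qed.

Lemma quotient_mul1 : left_id quotient_one quotient_mul.
Proof. by move=> a; rewrite -[a]quotient_reprK quotient_mulE mul1g. Qed.

Lemma quotient_mulr1 : right_id quotient_one quotient_mul.
Proof. by move=> a; rewrite -[a]quotient_reprK quotient_mulE mulg1. Qed.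

Lemma quotient_mulV : left_inverse quotient_one quotient_inv quotient_mul.
Proof.
by move=> a; rewrite -[a]quotient_reprK quotient_invE quotient_mulE mulVg.
Qed.

Lemma quotient_mulrV : right_inverse quotient_one quotient_inv quotient_mul.
Proof.
by move=> a; rewrite -[a]quotient_reprK quotient_invE quotient_mulE mulgV.
Qed.

HB.instance Definition _ := isGroup.Build quotient_group quotient_mulA
  quotient_mul1 quotient_mulr1 quotient_mulV quotient_mulrV.

End QuotientGroup.

Section Automorphisms.
Variable G : groupType.

Definition is_automorphism (f : G -> G) : bool :=
  `[< bijective f /\ {morph f : x y / x * y} >].

Record Aut := MkAut { aut_fun :> G -> G; aut_funP : is_automorphism aut_fun }.

HB.instance Definition _ := [isSub for aut_fun].
HB.instance Definition _ := [Choice of Aut by <:].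

Lemma aut_bij (f : Aut) : bijective f.
Proof. by have /asboolP[] := aut_funP f. Qed.

Lemma autM (f : Aut) : {morph f : x y / x * y}.
Proof. by have /asboolP[] := aut_funP f. Qed.

Lemma aut_eqP (f g : Aut) : f =1 g -> f = g.
Proof. by move=> fg; apply: val_inj; apply/funext. Qed.

Fact aut_one_subproof : is_automorphism idfun.
Proof. by apply/asboolP; split=> //; exists idfun. Qed.
Definition aut_one := MkAut aut_one_subproof.

Fact aut_mul_subproof (f g : Aut) : is_automorphism (f \o g).
Proof.
apply/asboolP; split; first exact: bij_comp (aut_bij f) (aut_bij g).
by move=> x y /=; rewrite !autM.
Qed.
Definition aut_mul f g := MkAut (aut_mul_subproof f g).

Fact aut_inv_exists (f : Aut) : exists g : G -> G, cancel f g /\ cancel g f.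
Proof. by have [g fK gK] := aut_bij f; exists g. Qed.
Definition aut_inv_fun f := projT1 (cid (aut_inv_exists f)).

Lemma aut_invK (f : Aut) : cancel f (aut_inv_fun f).
Proof. by rewrite /aut_inv_fun; case: cid => g []. Qed.

Lemma autK_inv (f : Aut) : cancel (aut_inv_fun f) f.
Proof. by rewrite /aut_inv_fun; case: cid => g []. Qed.

Fact aut_inv_subproof f : is_automorphism (aut_inv_fun f).
Proof.
apply/asboolP; split; first by exists f; [apply: autK_inv|apply: aut_invK].
by move=> x y; apply: (bij_inj (aut_bij f)); rewrite autM !autK_inv.
Qed.
Definition aut_inv f := MkAut (aut_inv_subproof f).

Lemma aut_mulA : associative aut_mul.
Proof. by move=> f g h; apply: aut_eqP. Qed.
Lemma aut_mul1 : left_id aut_one aut_mul.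
Proof. by move=> f; apply: aut_eqP. Qed.
Lemma aut_mulr1 : right_id aut_one aut_mul.
Proof. by move=> f; apply: aut_eqP. Qed.
Lemma aut_mulV : left_inverse aut_one aut_inv aut_mul.
Proof. by move=> f; apply: aut_eqP => x; apply: aut_invK. Qed.
Lemma aut_mulrV : right_inverse aut_one aut_inv aut_mul.
Proof. by move=> f; apply: aut_eqP => x; apply: autK_inv. Qed.

HB.instance Definition _ := isGroup.Build Aut aut_mulA
  aut_mul1 aut_mulr1 aut_mulV aut_mulrV.

Fact inner_subproof (h : G) : is_automorphism (fun x => h * x * h^-1).
Proof.
apply/asboolP; split; last by move=> x y; rewrite !mulgA mulgVK.
by exists (fun x => h^-1 * x * h) => x; rewrite !mulgA ?mulVg ?mulgV mul1g
  ?mulgVK ?mulgK.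
Qed.
Definition inner (h : G) : Aut := MkAut (inner_subproof h).

Lemma inner1 : inner 1 = 1.
Proof. by apply: aut_eqP => x /=; rewrite invg1 mulg1 mul1g. Qed.

Lemma innerM g h : inner (g * h) = inner g * inner h.
Proof. by apply: aut_eqP => x /=; rewrite invgM !mulgA. Qed.

Lemma innerV h : inner h^-1 = (inner h)^-1.
Proof. by apply: (@mulgI _ (inner h)); rewrite -innerM !mulgV inner1. Qed.

Lemma innerJ h (f : Aut) : inner h ^ f = inner (f^-1 h).
Proof.
apply: aut_eqP => x /=; apply: (bij_inj (aut_bij f)).
have fV (y : G) : f y^-1 = (f y)^-1.
  apply: (@mulgI _ (f y)); rewrite -autM !mulgV.
  by apply: (@mulgI _ (f 1)); rewrite -autM !mulg1.
by rewrite autK_inv !autM fV autK_inv.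
Qed.

Definition Inn_set : set Aut := range inner.

Fact Inn_set1 : Inn_set 1.
Proof. by exists 1 => //; apply: inner1. Qed.
Fact Inn_setM f g : Inn_set f -> Inn_set g -> Inn_set (f * g).
Proof. by move=> [x _ <-] [y _ <-]; exists (x * y) => //; apply: innerM. Qed.
Fact Inn_setV f : Inn_set f -> Inn_set f^-1.
Proof. by move=> [x _ <-]; exists x^-1 => //; apply: innerV. Qed.
Fact Inn_setJ f g : Inn_set f -> Inn_set (f ^ g).
Proof. by move=> [x _ <-]; rewrite innerJ; exists (g^-1 x). Qed.

Definition Inn : normalSubgroup Aut :=
  NormalSubgroup Inn_set1 Inn_setM Inn_setV Inn_setJ.

End Automorphisms.

Definition Out (G : groupType) : groupType := quotient_group (Inn G).

(* The letter (x, true) stands for the generator x, (x, false) for its        *)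
(* formal inverse.                                                            *)
Definition word (X : Type) := seq (X * bool).

Section Presentation.
Variables (X : choiceType) (R : word X -> word X -> Prop).

(* The congruence on words generated by free cancellation and the relations   *)
(* w1 = w2 for R w1 w2.                                                       *)
Inductive pres_eq : word X -> word X -> Prop :=
| pres_eq_refl w : pres_eq w w
| pres_eq_sym w1 w2 : pres_eq w1 w2 -> pres_eq w2 w1
| pres_eq_trans w1 w2 w3 : pres_eq w1 w2 -> pres_eq w2 w3 -> pres_eq w1 w3
| pres_eq_cat u1 u2 w1 w2 :
    pres_eq u1 u2 -> pres_eq w1 w2 -> pres_eq (u1 ++ w1) (u2 ++ w2)
| pres_eq_cancel x b : pres_eq [:: (x, b); (x, ~~ b)] [::]
| pres_eq_rel w1 w2 : R w1 w2 -> pres_eq w1 w2.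

Definition pres_rel : rel (word X) := fun w1 w2 => `[< pres_eq w1 w2 >].

Lemma pres_relP w1 w2 : reflect (pres_eq w1 w2) (pres_rel w1 w2).
Proof. exact: asboolP. Qed.

Lemma pres_rel_refl : reflexive pres_rel.
Proof. by move=> w; apply/pres_relP; apply: pres_eq_refl. Qed.

Lemma pres_rel_sym : symmetric pres_rel.
Proof. by move=> u w; apply/pres_relP/pres_relP; apply: pres_eq_sym. Qed.

Lemma pres_rel_trans : transitive pres_rel.
Proof.
move=> w2 w1 w3 /pres_relP w12 /pres_relP w23.
by apply/pres_relP; apply: pres_eq_trans w12 w23.
Qed.

Canonical pres_equiv :=
  EquivRel pres_rel pres_rel_refl pres_rel_sym pres_rel_trans.

Definition presented_group := {eq_quot pres_equiv}.

HB.instance Definition _ := Choice.on presented_group.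

Definition pres_pi (w : word X) : presented_group := \pi_presented_group w.

Lemma pres_piP w1 w2 : pres_pi w1 = pres_pi w2 <-> pres_eq w1 w2.
Proof.
split; first by move=> /eqmodP/pres_relP.
by move=> w12; apply/eqmodP/pres_relP.
Qed.

Lemma pres_reprK (a : presented_group) : pres_pi (repr a) = a.
Proof. exact: reprK. Qed.

Definition word_inv (w : word X) : word X := rev [seq (l.1, ~~ l.2) | l <- w].

Lemma word_inv_cat u w : word_inv (u ++ w) = word_inv w ++ word_inv u.
Proof. by rewrite /word_inv map_cat rev_cat. Qed.

Lemma word_invK : involutive word_inv.
Proof.
move=> w; rewrite /word_inv map_rev revK -map_comp -[RHS]map_id.
by apply: eq_map => -[x b] /=; rewrite negbK.
Qed.

Lemma pres_eq_mulV w : pres_eq (w ++ word_inv w) [::].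
Proof.
elim: w => [|[x b] w IHw]; first exact: pres_eq_refl.
rewrite -[_ :: w]/([:: (x, b)] ++ w) word_inv_cat -!catA [w ++ _]catA.
apply: pres_eq_trans (pres_eq_cancel x b).
rewrite -[[:: (x, b); _]]/([:: (x, b)] ++ ([::] ++ [:: (x, ~~ b)])).
apply: pres_eq_cat (pres_eq_refl _) _.
by apply: pres_eq_cat IHw _; apply: pres_eq_refl.
Qed.

Lemma pres_eq_Vmul w : pres_eq (word_inv w ++ w) [::].
Proof. by rewrite -{2}[w]word_invK; apply: pres_eq_mulV. Qed.

Lemma pres_eq_inv u w : pres_eq u w -> pres_eq (word_inv u) (word_inv w).
Proof.
move=> uw; apply: (@pres_eq_trans _ (word_inv u ++ (w ++ word_inv w))).
  rewrite -{1}[word_inv u]cats0; apply: pres_eq_cat (pres_eq_refl _) _.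
  exact/pres_eq_sym/pres_eq_mulV.
rewrite catA -{2}[word_inv w]cat0s; apply: pres_eq_cat (pres_eq_refl _).
apply: pres_eq_trans (pres_eq_Vmul u).
by apply: pres_eq_cat (pres_eq_refl _) _; apply: pres_eq_sym.
Qed.

Definition pres_one := pres_pi [::].
Definition pres_inv (a : presented_group) := pres_pi (word_inv (repr a)).
Definition pres_mul (a b : presented_group) := pres_pi (repr a ++ repr b).

Lemma pres_mulE u w : pres_mul (pres_pi u) (pres_pi w) = pres_pi (u ++ w).
Proof. by apply/pres_piP; apply: pres_eq_cat; apply/pres_piP/pres_reprK. Qed.

Lemma pres_invE w : pres_inv (pres_pi w) = pres_pi (word_inv w).
Proof. by apply/pres_piP; apply: pres_eq_inv; apply/pres_piP/pres_reprK. Qed.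

Lemma pres_mulA : associative pres_mul.
Proof.
move=> a b c; rewrite -[a]pres_reprK -[b]pres_reprK -[c]pres_reprK.
by rewrite !pres_mulE catA.
Qed.

Lemma pres_mul1 : left_id pres_one pres_mul.
Proof. by move=> a; rewrite -[a]pres_reprK pres_mulE. Qed.

Lemma pres_mulr1 : right_id pres_one pres_mul.
Proof. by move=> a; rewrite -[a]pres_reprK pres_mulE cats0. Qed.

Lemma pres_mulV : left_inverse pres_one pres_inv pres_mul.
Proof.
move=> a; rewrite -[a]pres_reprK pres_invE pres_mulE.
exact/pres_piP/pres_eq_Vmul.
Qed.

Lemma pres_mulrV : right_inverse pres_one pres_inv pres_mul.
Proof.
move=> a; rewrite -[a]pres_reprK pres_invE pres_mulE.
exact/pres_piP/pres_eq_mulV.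
Qed.

HB.instance Definition _ := isGroup.Build presented_group pres_mulA
  pres_mul1 pres_mulr1 pres_mulV pres_mulrV.

Definition pres_gen (x : X) : presented_group := pres_pi [:: (x, true)].

End Presentation.

Record sgraph := SGraph {
  vertex :> finType;
  adj : rel vertex;
  adj_sym : symmetric adj;
  adj_irrefl : irreflexive adj
}.

Section Graphs.
Variable Gamma : sgraph.
Implicit Types (u v : Gamma) (A : {set Gamma}).

Definition link v : {set Gamma} := [set u | adj v u].
Definition star v : {set Gamma} := v |: link v.
Definition dominates u v : bool := link v \subset star u.

Definition graph_automorphism (f : Gamma -> Gamma) : Prop :=
  bijective f /\ {mono f : u v / adj u v}.

Definition graph_connected : Prop := forall u v, connect (@adj Gamma) u v.

Definition induced_adj A : rel {x : Gamma | x \in A} :=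
  fun x y => adj (val x) (val y).

Fact induced_sym A : symmetric (@induced_adj A).
Proof. by move=> x y; apply: adj_sym. Qed.
Fact induced_irrefl A : irreflexive (@induced_adj A).
Proof. by move=> x; apply: adj_irrefl. Qed.

Definition induced A : sgraph := SGraph (@induced_sym A) (@induced_irrefl A).

End Graphs.

(* With at least two vertices, the absence of domination forces the           *)
(* complement of every star to be nonempty, so the convention that the empty  *)
(* graph is connected plays no role there.                                    *)
Record austere (Gamma : sgraph) : Prop := Austere {
  austere_aut : forall f : Gamma -> Gamma, graph_automorphism f -> f =1 id;
  austere_dom : forall u v : Gamma, u != v -> ~~ dominates u v;
  austere_conn : forall v : Gamma, graph_connected (induced (~: star v))
}.

Inductive raag_rel (Gamma : sgraph) : word Gamma -> word Gamma -> Prop :=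
| RaagRel (u v : Gamma) : adj u v ->
    raag_rel [:: (u, true); (v, true)] [:: (v, true); (u, true)].

Definition raag (Gamma : sgraph) : groupType :=
  presented_group (@raag_rel Gamma).

(* Main.v *)
Require Import Defs.
From HB Require Import structures.
From mathcomp Require Import boolp classical_sets cardinality.
From mathcomp Require Import all_boot all_order all_algebra perm.
From mathcomp Require Import zify ring.

(** Let A be the right-angled Artin group of an austere graph.

  Every automorphism of A is the product of an inner automorphism and of
inversions of generators (aut_decomposition), in a unique way
(aut_decomposition_inj). Granting this, Aut(A) is the semidirect product of
Inn(A), a copy of A since the centre is trivial, with the elementary abelian
2-group of inversions. Choose for each vertex v a vertex far v outside the star
of v, which exists since otherwise v would dominate all the other vertices. For
a set D of vertices one may replace the inner automorphism of v, for v in D, by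
its product with the inversion of far v, and keep the inversions: this respects
the relations, since far v is neither equal nor adjacent to v. The result is an
involutive automorphism of Aut(A) (twisted). Two different sets D give different
outer classes, because an inner automorphism acts trivially on homology while
its product with an inversion does not (twisted_out_inj). This gives 2^n
classes.

  The decomposition is the special case for austere graphs of a theorem of
Laurence, proved here in two steps.

  On homology: if f is an automorphism and f v has a nonzero coordinate in w,
the images of the vertices of st v commute with f v, and in the second quotient
of the lower central series this means that their homology classes are
determined by the coordinates in st w. So st v has at most as many elements as
st w. A nonzero term of the determinant provides a permutation s of the vertices
for which f v has a nonzero coordinate in s v; comparing cardinals, all these
inequalities are equalities, and then the absence of domination forces the class
of f v to be a multiple of s v. The permutation s is a graph automorphism, hence
trivial, and f acts on homology by signs (homology_diagonal, homology_sign).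

  For f acting trivially on homology: A is for each vertex w an HNN extension
with base C_w, generated by the other vertices, and acts on its Bass-Serre tree,
which is constructed here from normal forms (vertex_tree_metric). If f v, with v
different from w, had no fixed vertex, then f v and f u for u in lk v would
translate a common axis, and some combination of them would fix an edge, which
homology excludes unless u is in lk w; this for all u would make w dominate v.
So f v has fixed vertices in the tree of w, a single one for v outside st w, and
the connectedness of the complement of st w shows that all f v, v different from
w, fix the same one (torelli_common_fixed). It follows that, after composition
with an inner automorphism depending on w, f preserves C_w and the special
subgroup of lk w. Then f w centralises lk w, which leaves only f w = w
(torelli_normalize). The inner automorphisms are adjusted to a common one by
induction on the set of vertices w considered (torelli_preserves_all), and an
automorphism that is trivial on homology and preserves every C_w is the
identity, since the intersection of the C_w over the vertices w other than v is
generated by v. *)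

Set Implicit Arguments.
Unset Strict Implicit.
Unset Printing Implicit Defensive.

Import GRing.Theory Num.Theory Order.TTheory.

Local Open Scope group_scope.

(** * Homomorphisms and presentations *)

Section Homomorphisms.
Variables (G H : groupType) (f : G -> H).
Hypothesis fM : {morph f : x y / x * y}.

Lemma hom1 : f 1 = 1.
Proof. by apply: (@mulgI _ (f 1)); rewrite -fM !mulg1. Qed.

Lemma homV x : f x^-1 = (f x)^-1.
Proof. by apply: (@mulgI _ (f x)); rewrite -fM !mulgV hom1. Qed.

End Homomorphisms.

Section Lift.
Variables (X : choiceType) (R : word X -> word X -> Prop) (H : groupType).
Variable f : X -> H.

Definition letter_eval (l : X * bool) : H := if l.2 then f l.1 else (f l.1)^-1.

Definition word_eval (w : word X) : H :=
  foldr (fun l h => letter_eval l * h) 1 w.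

Lemma word_eval_cat u w : word_eval (u ++ w) = word_eval u * word_eval w.
Proof. by elim: u => [|l u IHu] /=; rewrite ?mul1g // IHu mulgA. Qed.

Hypothesis fR : forall w1 w2, R w1 w2 -> word_eval w1 = word_eval w2.

Lemma word_eval_pres_eq w1 w2 : pres_eq R w1 w2 -> word_eval w1 = word_eval w2.
Proof.
elim=> {w1 w2} // [w1 w2 w3 _ -> _ -> //|u1 u2 w1 w2 _ eu _ ew|x b].
  by rewrite !word_eval_cat eu ew.
by rewrite /= mulg1 /letter_eval; case: b; rewrite /= ?mulgV ?mulVg.
Qed.

Definition lift (g : presented_group R) : H := word_eval (repr g).

Lemma lift_pi w : lift (pres_pi R w) = word_eval w.
Proof. by apply: word_eval_pres_eq; apply/pres_piP; apply: pres_reprK. Qed.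

Lemma liftM : {morph lift : x y / x * y}.
Proof.
by move=> x y; rewrite [x * y]/(pres_mul x y) /pres_mul lift_pi word_eval_cat.
Qed.

Lemma lift_gen x : lift (pres_gen R x) = f x.
Proof. by rewrite lift_pi /= mulg1. Qed.

End Lift.

Section PresentedGroupInduction.
Variables (X : choiceType) (R : word X -> word X -> Prop).

Lemma pres_pi_cons x b w : pres_pi R ((x, b) :: w) =
  (if b then pres_gen R x else (pres_gen R x)^-1) * pres_pi R w.
Proof.
case: b; first by rewrite [RHS]pres_mulE.
have -> : (pres_gen R x)^-1 = pres_pi R [:: (x, false)].
  by rewrite [LHS]pres_invE.
by rewrite [RHS]pres_mulE.
Qed.

Lemma presented_group_ind (P : presented_group R -> Prop) :
    P 1 -> (forall x g, P g -> P (pres_gen R x * g)) ->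
    (forall x g, P g -> P ((pres_gen R x)^-1 * g)) -> forall g, P g.
Proof.
move=> P1 PM PV g; rewrite -[g]pres_reprK; elim: (repr g) => // -[x b] w IHw.
by rewrite pres_pi_cons; case: b; [apply: PM|apply: PV].
Qed.

Lemma hom_ext (H : groupType) (f1 f2 : presented_group R -> H) :
    {morph f1 : x y / x * y} -> {morph f2 : x y / x * y} ->
    (forall x, f1 (pres_gen R x) = f2 (pres_gen R x)) -> f1 =1 f2.
Proof.
move=> f1M f2M f12; apply: presented_group_ind => [|x g fg|x g fg].
- by rewrite !hom1.
- by rewrite f1M f2M f12 fg.
by rewrite f1M f2M !homV // f12 fg.
Qed.

End PresentedGroupInduction.

(** * Right-angled Artin groups: retractions and exponent sums *)

(** The integral Heisenberg group, with (a, b, c) the upper unitriangular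
matrix of entries a, b above the diagonal and c in the corner. *)
Definition heisenberg := (int * int * int)%type.

HB.instance Definition _ := Choice.on heisenberg.

Section Heisenberg.
Local Open Scope ring_scope.
Implicit Types g h : heisenberg.

Definition heis_mul g h : heisenberg :=
  (g.1.1 + h.1.1, g.1.2 + h.1.2, g.2 + h.2 + g.1.1 * h.1.2).
Definition heis_inv g : heisenberg :=
  (- g.1.1, - g.1.2, g.1.1 * g.1.2 - g.2).
Definition heis_one : heisenberg := (0, 0, 0).

Lemma heis_mulA : associative heis_mul.
Proof.
by move=> [[? ?] ?] [[? ?] ?] [[? ?] ?]; congr (_, _, _) => /=; ring.
Qed.
Lemma heis_mul1 : left_id heis_one heis_mul.
Proof. by move=> [[? ?] ?]; congr (_, _, _) => /=; ring. Qed.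
Lemma heis_mulr1 : right_id heis_one heis_mul.
Proof. by move=> [[? ?] ?]; congr (_, _, _) => /=; ring. Qed.
Lemma heis_mulV : left_inverse heis_one heis_inv heis_mul.
Proof. by move=> [[? ?] ?]; congr (_, _, _) => /=; ring. Qed.
Lemma heis_mulrV : right_inverse heis_one heis_inv heis_mul.
Proof. by move=> [[? ?] ?]; congr (_, _, _) => /=; ring. Qed.

HB.instance Definition _ := isGroup.Build heisenberg heis_mulA
  heis_mul1 heis_mulr1 heis_mulV heis_mulrV.

End Heisenberg.

Section Raag.
Variable Gamma : sgraph.
Local Notation A := (raag Gamma).
Implicit Types (u v w x y : Gamma) (S T : {set Gamma}) (g h : A).

Definition gen v : A := pres_gen (@raag_rel Gamma) v.

Lemma gen_commute u v : adj u v -> commute (gen u) (gen v).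
Proof.
move=> uv; rewrite /commute [LHS]pres_mulE [RHS]pres_mulE.
by apply/pres_piP/pres_eq_rel/RaagRel.
Qed.

Lemma raag_ind (P : A -> Prop) :
    P 1 -> (forall x g, P g -> P (gen x * g)) ->
    (forall x g, P g -> P ((gen x)^-1 * g)) -> forall g, P g.
Proof. exact: presented_group_ind. Qed.

Lemma raag_hom_ext (H : groupType) (f1 f2 : A -> H) :
    {morph f1 : x y / x * y} -> {morph f2 : x y / x * y} ->
    (forall x, f1 (gen x) = f2 (gen x)) -> f1 =1 f2.
Proof. exact: hom_ext. Qed.

Section RaagLift.
Variables (H : groupType) (f : Gamma -> H).
Hypothesis f_comm : forall u v, adj u v -> commute (f u) (f v).

Let f_rel (w1 w2 : word Gamma) :
  raag_rel w1 w2 -> word_eval f w1 = word_eval f w2.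
Proof. by case=> u v uv; rewrite /= !mulg1; apply: f_comm. Qed.

Definition raag_lift : A -> H := @lift _ _ _ f.

Lemma raag_liftM : {morph raag_lift : g h / g * h}.
Proof. exact: liftM f_rel. Qed.

Lemma raag_lift_gen v : raag_lift (gen v) = f v.
Proof. exact: (lift_gen f_rel). Qed.

End RaagLift.

Definition ret_gen S v : A := if v \in S then gen v else 1.

Fact ret_gen_comm S u v : adj u v -> commute (ret_gen S u) (ret_gen S v).
Proof.
move=> uv; rewrite /ret_gen; case: ifP => _; last exact/commute_sym/commute1.
by case: ifP => _; [apply: gen_commute|apply: commute1].
Qed.

Definition ret S : A -> A := raag_lift (ret_gen S).

Lemma retM S : {morph ret S : g h / g * h}.
Proof. exact/raag_liftM/ret_gen_comm. Qed.

Lemma retV S g : ret S g^-1 = (ret S g)^-1.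
Proof. exact: homV (retM S) g. Qed.

Lemma ret1 S : ret S 1 = 1.
Proof. exact: hom1 (retM S). Qed.

Lemma ret_genE S v : ret S (gen v) = if v \in S then gen v else 1.
Proof. exact/raag_lift_gen/ret_gen_comm. Qed.

Lemma retI S T g : ret S (ret T g) = ret (S :&: T) g.
Proof.
apply: (@raag_hom_ext _ (fun g => ret S (ret T g))) => [x y|x y|v].
- by rewrite !retM.
- exact: retM.
rewrite !ret_genE inE; case: (v \in T); rewrite ?ret1 ?ret_genE ?andbT //.
by rewrite andbF.
Qed.

Lemma ret_set0 g : ret set0 g = 1.
Proof.
apply: (@raag_hom_ext _ (ret set0) (fun=> 1)) => [x y|x y|v].
- exact: retM.
- by rewrite mulg1.
by rewrite ret_genE inE.
Qed.

(** The special subgroup generated by S. Describing it as the fixed points of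
the retraction that kills the other generators makes its stability under
intersections and under retractions a computation. *)
Definition par S g : Prop := ret S g = g.

Lemma par_ret S g : par S (ret S g).
Proof. by rewrite /par retI setIid. Qed.

Lemma par1 S : par S 1. Proof. exact: ret1. Qed.

Lemma parM S g h : par S g -> par S h -> par S (g * h).
Proof. by rewrite /par retM => -> ->. Qed.

Lemma parV S g : par S g -> par S g^-1.
Proof. by rewrite /par retV => ->. Qed.

Lemma par_gen S v : v \in S -> par S (gen v).
Proof. by rewrite /par ret_genE => ->. Qed.

Lemma parI S T g : par S g -> par T g -> par (S :&: T) g.
Proof. by rewrite /par => Sg Tg; rewrite -retI Tg. Qed.

Lemma parS S T g : S \subset T -> par S g -> par T g.
Proof. by move=> /setIidPr ST Sg; rewrite /par -{1}Sg retI ST. Qed.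

Lemma par_all S g : (forall v, v \notin S -> par (~: [set v]) g) -> par S g.
Proof.
move=> Sg; have: forall s : seq Gamma, {subset s <= ~: S} ->
    par (~: [set x in s]) g.
  elim=> [_|v s IHs vs].
    suff: forall h, ret setT h = h by rewrite set_nil setC0; apply.
    apply: (@raag_hom_ext _ (ret setT) id) => [x y|//|v]; first exact: retM.
    by rewrite ret_genE inE.
  have -> : ~: [set x in v :: s] = ~: [set v] :&: ~: [set x in s].
    by rewrite set_cons setCU.
  apply: parI; first by apply: Sg; have := vs v (mem_head _ _); rewrite inE.
  by apply: IHs => x xs; apply: vs; rewrite inE xs orbT.
move/(_ (enum (~: S))); rewrite (_ : [set x in enum (~: S)] = ~: S).
  by rewrite setCK; apply=> x; rewrite mem_enum.
by apply/setP=> x; rewrite inE mem_enum.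
Qed.

Lemma par_ind S (P : A -> Prop) :
    P 1 -> (forall g h, P g -> P h -> P (g * h)) ->
    (forall g, P g -> P g^-1) -> (forall v, v \in S -> P (gen v)) ->
  forall g, par S g -> P g.
Proof.
move=> P1 PM PV Pgen g <-.
have Pret v : P (ret S (gen v)) by rewrite ret_genE; case: ifP => // /Pgen.
elim/raag_ind: g => [|v g Pg|v g Pg]; rewrite ?ret1 // retM ?retV.
  exact: PM.
apply: PM => //.
exact: PV.
Qed.

Lemma commute_par S h g : (forall v, v \in S -> commute h (gen v)) ->
  par S g -> commute h g.
Proof.
move=> hS; apply: par_ind => //; first exact: commute1.
  by move=> k1 k2; apply: commuteM.
by move=> k; apply: commuteV.
Qed.

Lemma commute_par_link v g : par (link v) g -> commute (gen v) g.
Proof. by apply: commute_par => u; rewrite inE; apply: gen_commute. Qed.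

Lemma link_sub v : link v \subset ~: [set v].
Proof.
apply/fintype.subsetP => x; rewrite !inE; case: eqP => // ->.
by rewrite adj_irrefl.
Qed.

(** ** Exponent sums *)

Definition heis_gen x y v : heisenberg := ((Posz (v == x), Posz (v == y)), 0%R).

Definition nonadj x y := [&& x != y & ~~ adj x y].

Fact heis_gen_comm x y : nonadj x y ->
  forall u v, adj u v -> commute (heis_gen x y u) (heis_gen x y v).
Proof.
move=> /andP[xy nxy] u v uv; rewrite /commute /heis_gen.
congr ((_, _), _); rewrite /= 1?[in RHS]addrC //.
have : ~~ ((u == x) && (v == y)) by apply: contra nxy => /andP[/eqP<- /eqP<-].
have : ~~ ((v == x) && (u == y)).
  by apply: contra nxy => /andP[/eqP<- /eqP<-]; rewrite adj_sym.
by do 4!case: eqP => _.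
Qed.

Fact expsum_gen_comm x u v : adj u v ->
  commute (((Posz (u == x), 0%R), 0%R) : heisenberg)
    ((Posz (v == x), 0%R), 0%R).
Proof.
by move=> _; rewrite /commute; congr ((_, _), _); rewrite /= ?mulr0 // addrC.
Qed.

(** The exponent sum of x, read in the abelian subgroup of the Heisenberg group
where only the first coordinate is nonzero. *)
Definition expsum x g : int :=
  (raag_lift (fun v => ((Posz (v == x), 0%R), 0%R) : heisenberg) g).1.1.

Lemma expsumM x g h : (expsum x (g * h) = expsum x g + expsum x h)%R.
Proof. by rewrite /expsum raag_liftM //; apply: expsum_gen_comm. Qed.

Lemma expsum_genE x v : expsum x (gen v) = Posz (v == x).
Proof. by rewrite /expsum raag_lift_gen //; apply: expsum_gen_comm. Qed.

Lemma expsum1 x : expsum x 1 = 0%R.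
Proof. by apply: (@addIr _ (expsum x 1)); rewrite -expsumM mulg1 add0r. Qed.

Lemma expsumV x g : (expsum x g^-1 = - expsum x g)%R.
Proof.
by apply: (@addrI _ (expsum x g)); rewrite -expsumM mulgV subrr expsum1.
Qed.

Lemma expsumX x g n : (expsum x (g ^+ n) = expsum x g *+ n)%R.
Proof. by elim: n => [|n IHn]; rewrite ?expsum1 // expgS expsumM IHn mulrS. Qed.

Lemma expsumJ x g h : expsum x (g * h * g^-1) = expsum x h.
Proof. by rewrite !expsumM expsumV addrC addKr. Qed.

Lemma par_expsum S x g : par S g -> x \notin S -> expsum x g = 0%R.
Proof.
move=> Sg xS; elim/(@par_ind S): Sg => [|g1 g2 e1 e2|g1 e1|v vS].
- exact: expsum1.
- by rewrite expsumM e1 e2.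
- by rewrite expsumV e1 oppr0.
by rewrite expsum_genE; case: eqP xS vS => // <- /negPf->.
Qed.

(** Two elements that commute in the group commute in each Heisenberg quotient
attached to a pair of nonadjacent vertices; in the Lie ring of the lower central
series this says that the degree two part is free on such pairs. *)
Lemma commute_expsum x y g h : nonadj x y -> commute g h ->
  (expsum x g * expsum y h = expsum x h * expsum y g)%R.
Proof.
move=> xy gh; set f := raag_lift (heis_gen x y).
have fM : {morph f : g h / g * h} by exact/raag_liftM/heis_gen_comm.
have fx k : (f k).1.1 = expsum x k /\ (f k).1.2 = expsum y k.
  elim/raag_ind: k => [|v k [IHx IHy]|v k [IHx IHy]].
  - by rewrite !expsum1 (hom1 fM).
  - rewrite fM !expsumM -IHx -IHy /f raag_lift_gen; last exact: heis_gen_comm.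
    by rewrite !expsum_genE.
  - rewrite fM (homV fM) !expsumM !expsumV -IHx -IHy /f raag_lift_gen.
      by rewrite !expsum_genE.
    exact: heis_gen_comm.
have := congr1 (fun k : heisenberg => k.2) (congr1 f gh); rewrite /= !fM /=.
have [<- <-] := fx g; have [<- <-] := fx h.
by lia.
Qed.

(** ** Cyclic special subgroups *)

Lemma par_set1 v g : par [set v] g -> expsum v g = 1%R -> g = gen v.
Proof.
move=> /(@par_ind [set v] (fun g => exists m n, g = gen v ^+ m * gen v ^- n)) H.
have comm m n : commute (gen v ^+ m) (gen v ^- n).
  by apply/commuteV/commuteX2/commute_refl.
have [||||m [n ->]] := H.
- by exists 0, 0; rewrite !expg0 mulgV.
- move=> _ _ [m1 [n1 ->]] [m2 [n2 ->]]; exists (m1 + m2), (n2 + n1).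
  by rewrite !expgnDr invgM !mulgA -[_ * _ * gen v ^+ m2]mulgA -comm !mulgA.
- by move=> _ [m [n ->]]; exists n, m; rewrite invgM invgK.
- by move=> x /set1P->; exists 1%N, 0; rewrite invg1 mulg1.
rewrite expsumM expsumV !expsumX expsum_genE eqxx => mn.
have -> : m = n.+1 by lia.
by rewrite expgS mulgK.
Qed.

(** When the generators of S commute with z, the special subgroup of z |: S is
a direct product, with the two retractions as projections. *)
Lemma par_setU1 z S g : S \subset link z -> par (z |: S) g ->
  g = ret [set z] g * ret S g.
Proof.
move=> Sz <-; move: {g}(g) => g.
have zS : z \notin S.
  by apply/negP => /(fintype.subsetP Sz); rewrite inE adj_irrefl.
have comm h k : commute (ret S h) (ret [set z] k).
  apply: (commute_par _ (par_ret _ _)) => x /set1P->; apply/commute_sym.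
  exact/commute_par_link/(parS Sz)/par_ret.
rewrite !retI.
have -> : [set z] :&: (z |: S) = [set z] by apply/setIidPl; rewrite subsetUl.
have -> : S :&: (z |: S) = S by apply/setIidPl; rewrite subsetUr.
apply: (@raag_hom_ext _ (ret _) (fun g => ret [set z] g * ret S g)).
- exact: retM.
- move=> h k; rewrite !retM !mulgA -[ret _ _ * ret S h * _]mulgA (comm h k).
  by rewrite !mulgA.
move=> v; rewrite !ret_genE !inE; case: eqP => [->|_] /=.
  by rewrite (negPf zS) mulg1.
by rewrite mul1g.
Qed.

End Raag.

(** * Commuting isometries of a tree *)

Section TreeMetric.
Variables (G : groupType) (d : G -> G -> nat).

(** G acts on a tree, d x y is the distance between the images of a base vertex
under x and y. The four-point condition is the metric form of the absence of
cycles, the last clause says that geodesics exist. *)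
Record tree_metric : Prop := TreeMetric {
  tm_inv : forall k x y, d (k * x) (k * y) = d x y;
  tm_xx : forall x, d x x = 0;
  tm_sym : forall x y, d x y = d y x;
  tm_four : forall x y z t,
    d x y + d z t <= maxn (d x z + d y t) (d x t + d y z);
  tm_step : forall x y n, d x y = n.+1 -> exists z, d x z = 1%N /\ d z y = n
}.

Hypothesis dT : tree_metric.

Let dI := tm_inv dT.
Let dxx := tm_xx dT.
Let dC := tm_sym dT.
Let d4 := tm_four dT.

Lemma tm_triangle x y z : d x z <= d x y + d y z.
Proof. by have := d4 x z y y; rewrite dxx [d z y]dC; lia. Qed.

(** If all displacements of a are at least 2, a vertex x of least displacement
lies on an axis, that is, the geodesics from x to a x and from a x to a^2 x do
not overlap: otherwise a step towards a x would decrease the displacement. *)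
Lemma tm_axis a x :
    (forall y, d x (a * x) <= d y (a * y)) -> (1 < d x (a * x))%N ->
  d x (a * (a * x)) = d x (a * x) + d x (a * x).
Proof.
move=> xmin; case E: (d x (a * x)) => [//|n] n1.
have [z [xz zax]] := tm_step dT E; have := xmin z; rewrite E => zmin.
have := dI a x (a * x); have := dI a z (a * x); have := dI a x z.
rewrite xz zax E => H1 H2 H3.
have := tm_triangle x (a * x) (a * (a * x)).
have := d4 x (a * z) (a * x) (a * (a * x)).
have := d4 z (a * z) x (a * x).
rewrite [d (a * z) (a * x)]dC [d z x]dC [d (a * z) x]dC.
by lia.
Qed.

(** The point y projects to one of the two halves of the geodesic from p to r with
midpoint q; as it is no farther from q than from p and r, the geodesic from y to
the end of the other half passes through q. *)
Lemma tm_near_line p q r y l : d p q = l -> d q r = l -> d p r = l + l ->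
  d q y <= d p y -> d q y <= d r y -> d y r = d y q + l \/ d y p = d y q + l.
Proof.
have := tm_triangle y q r; have := tm_triangle y q p; have := d4 y q p r.
by rewrite ![d q y]dC [d p y]dC [d r y]dC [d q p]dC; lia.
Qed.

Section CommutingPair.
Variables (a b : G) (Z : G -> Prop).
Hypotheses (ZM : forall x y, Z x -> Z y -> Z (x * y)).
Hypotheses (ZV : forall x, Z x -> Z x^-1) (Za : Z a).
Hypotheses (commZa : forall z, Z z -> commute a z).
Hypotheses (commZb : forall z, Z z -> commute b z).

(** Both x and y have least displacement, so y lies on the axis of a through x:
if y were off this axis, the geodesic from y to a y would pass through it and be
longer than the translation length. *)
Lemma tm_between x y : (forall y, d x (a * x) <= d y (a * y)) ->
    (1 < d x (a * x))%N -> d y (a * y) = d x (a * x) ->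
  exists2 z, Z z & d (z * x) y + d y (z * (a * x)) = d x (a * x).
Proof.
move=> xmin l1 yl.
have [z Zz zmin] :
    exists2 z, Z z & forall z', Z z' -> d (z * x) y <= d (z' * x) y.
  have ex : exists n, `[< exists2 z, Z z & d (z * x) y = n >].
    by exists (d (a * x) y); apply/asboolP; exists a.
  case: (ex_minnP ex) => m /asboolP[z Zz <-] zmin.
  by exists z => // z' Zz'; apply: zmin; apply/asboolP; exists z'.
(* Three consecutive translates of x, the middle one x0 being closest to y. *)
have [x0 x0E] : exists x0, x0 = z * x by exists (z * x).
have [xp xpE] : exists xp, xp = z * a^-1 * x by exists (z * a^-1 * x).
have [xn xnE] : exists xn, xn = z * a * x by exists (z * a * x).
have axp : a * xp = x0 by rewrite xpE x0E !mulgA (commZa Zz) mulgK.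
have ax0 : a * x0 = xn by rewrite x0E xnE mulgA (commZa Zz).
have l0 : d x0 xn = d x (a * x) by rewrite x0E xnE -mulgA dI.
have lp : d xp x0 = d x (a * x) by rewrite -l0 -(dI a xp) axp ax0.
have lpn : d xp xn = d x (a * x) + d x (a * x).
  rewrite -(tm_axis xmin l1) -[RHS](dI (z * a^-1)) xpE xnE; congr (d _ _).
  by rewrite !mulgA mulgVK.
have mp : d x0 y <= d xp y.
  by rewrite x0E xpE; apply: zmin; apply: ZM => //; apply: ZV.
have mn : d x0 y <= d xn y by rewrite x0E xnE; apply: zmin; apply: ZM.
have eyn : d (a * y) xn = d y x0 by rewrite -(dI a y) ax0.
have eyp : d (a * y) x0 = d y xp by rewrite -(dI a y) axp.
have := d4 y xn (a * y) x0.
rewrite eyp yl [d xn x0]dC l0 [d xn (a * y)]dC eyn => H2.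
have near := tm_near_line lp l0 lpn mp mn.
rewrite ![d _ y]dC in mp mn; case: near => [yn|yp].
  exists (z * a^-1); first by apply: ZM => //; apply: ZV.
  rewrite -xpE !mulgA mulgVK -x0E.
  by have := tm_triangle xp y x0; rewrite ![d xp y]dC; lia.
exists z => //; rewrite mulgA -x0E -xnE.
by have := tm_triangle x0 y xn; rewrite ![d x0 y]dC; lia.
Qed.

(** A Euclidean algorithm on translation lengths, by pigeonhole: each b^i x lies
between two consecutive translates of x under elements of Z, at one of finitely
many distances from the first, and two points of a geodesic at the same distance
from its origin coincide. *)
Lemma tm_commuting_fix : commute a b -> (forall x, 1 < d x (a * x))%N ->
  exists i z x, [/\ 0 < i, Z z & d (b ^+ i * z * x) x = 0].
Proof.
move=> ab a_hyp.
have [x xmin] : exists x, forall y, d x (a * x) <= d y (a * y).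
  have ex : exists n, `[< exists x, d x (a * x) = n >].
    by exists (d 1 (a * 1)); apply/asboolP; exists 1.
  case: (ex_minnP ex) => m /asboolP[x <-] xmin.
  by exists x => y; apply: xmin; apply/asboolP; exists y.
set l := d x (a * x).
have abi i : commute a (b ^+ i) by apply: commuteX.
have between i : exists2 z, Z z &
    d (z * x) (b ^+ i * x) + d (b ^+ i * x) (z * (a * x)) = l.
  by apply: tm_between => //; rewrite mulgA abi -mulgA dI.
pose zz i := sval (cid2 (between i)).
have Zzz i : Z (zz i) by rewrite /zz; case: cid2.
have zzP i : d (zz i * x) (b ^+ i * x) + d (b ^+ i * x) (zz i * (a * x)) = l.
  by rewrite /zz; case: cid2.
have rP i : d (zz i * x) (b ^+ i * x) < l.+1 by rewrite ltnS -(zzP i) leq_addr.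
pose r (i : 'I_l.+2) : 'I_l.+1 := Ordinal (rP i).
have [i [j [ij rij]]] : exists i j : 'I_l.+2, i < j /\ r i = r j.
  have /injectivePn[i [j ij rij]] : ~~ injectiveb r.
    by apply/negP => /injectiveP/leq_card; rewrite !card_ord ltnn.
  case: (ltngtP i j) => [lt|gt|/val_inj/eqP]; last by rewrite (negPf ij).
    by exists i, j.
  by exists j, i.
have {}rij : d (zz i * x) (b ^+ i * x) = d (zz j * x) (b ^+ j * x).
  by case: rij.
exists (j - i), (zz i * (zz j)^-1), x; split.
- by rewrite subn_gt0.
- by apply: ZM => //; apply: ZV.
have bZ n z : Z z -> b ^+ n * z = z * b ^+ n.
  by move=> Zz; apply/commute_sym/commuteX/commute_sym/commZb.
pose y n := (zz n)^-1 * b ^+ n * x.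
have y0 n : d x (y n) = d (zz n * x) (b ^+ n * x).
  by rewrite -(dI (zz n)) !mulgA mulgV mul1g.
have y1 n : d (y n) (a * x) = d (b ^+ n * x) (zz n * (a * x)).
  by rewrite -(dI (zz n)) !mulgA mulgV mul1g.
have yij : d (y i) (y j) = 0.
  have := d4 (y i) (y j) x (a * x); rewrite ![d (y _) x]dC !y1 !y0.
  by have := zzP i; have := zzP j; rewrite -/l; lia.
have Zij : Z (zz i * (zz j)^-1) by apply: ZM => //; apply: ZV.
rewrite -yij dC -[RHS](dI ((b ^+ i)^-1 * zz i)) /y !mulgA; congr (d _ _).
  by rewrite mulgK mulVg mul1g.
rewrite -[b ^- i * _ * _]mulgA -[b ^- i * _ * b ^+ j]mulgA -bZ // mulgA.
by rewrite -{3}(subnKC (ltnW ij)) expgnDr mulKg !mulgA.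
Qed.

End CommutingPair.
End TreeMetric.

(** * The Bass-Serre tree of a vertex *)

Section SequenceDistance.
Variable T : eqType.
Implicit Types s t u : seq T.

Fixpoint lcp s t : nat :=
  match s, t with
  | x :: s', y :: t' => if x == y then (lcp s' t').+1 else 0
  | _, _ => 0
  end.

Definition seq_dist s t : nat := size s + size t - (lcp s t).*2.

Lemma lcp_size s t : lcp s t <= size s /\ lcp s t <= size t.
Proof.
elim: s t => [|x s IHs] [|y t] //=; case: eqP => _ //=.
by have [] := IHs t; split.
Qed.

Lemma lcpC s t : lcp s t = lcp t s.
Proof. by elim: s t => [|x s IHs] [|y t] //=; rewrite eq_sym IHs. Qed.

Lemma lcp_refl s : lcp s s = size s.
Proof. by elim: s => //= x s ->; rewrite eqxx. Qed.

Lemma lcp_ultra s t u : minn (lcp s t) (lcp t u) <= lcp s u.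
Proof.
elim: s t u => [|x s IHs] [|y t] [|z u] //=; rewrite ?min0n ?minn0 //.
case: (x =P y) => [<-|]; last by rewrite min0n.
by case: (x =P z) => _; rewrite ?minn0 // minnSS ltnS.
Qed.

Lemma seq_dist_xx s : seq_dist s s = 0.
Proof. by rewrite /seq_dist lcp_refl addnn subnn. Qed.

Lemma seq_distC s t : seq_dist s t = seq_dist t s.
Proof. by rewrite /seq_dist lcpC addnC. Qed.

Lemma seq_dist0s s : seq_dist [::] s = size s.
Proof. by rewrite /seq_dist /= subn0. Qed.

Lemma seq_dist0 s t : seq_dist s t = 0 -> s = t.
Proof.
rewrite /seq_dist; elim: s t => [|x s IHs] [|y t] //=.
case: eqP => [<-|_]; last by rewrite subn0.
by move=> H; congr cons; apply: IHs; lia.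
Qed.

Lemma seq_dist_cons x s t : seq_dist (x :: s) (x :: t) = seq_dist s t.
Proof. by rewrite /seq_dist /= eqxx; lia. Qed.

Lemma seq_dist_four s t u v : seq_dist s t + seq_dist u v
  <= maxn (seq_dist s u + seq_dist t v) (seq_dist s v + seq_dist t u).
Proof.
have : minn (lcp s u + lcp t v) (lcp s v + lcp t u) <= lcp s t + lcp u v.
  have := lcp_ultra s u t; have := lcp_ultra s v t.
  have := lcp_ultra u s v; have := lcp_ultra u t v.
  rewrite [lcp u t]lcpC [lcp v t]lcpC [lcp u s]lcpC.
  move: (lcp s t) (lcp s u) (lcp s v) (lcp t u) (lcp t v) (lcp u v) => *; lia.
rewrite /seq_dist.
have [] := lcp_size s t; have [] := lcp_size u v; have [] := lcp_size s u.
have [] := lcp_size t v; have [] := lcp_size s v; have [] := lcp_size t u.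
move: (size s) (size t) (size u) (size v) (lcp s t) (lcp s u) (lcp s v)
  (lcp t u) (lcp t v) (lcp u v) => *; lia.
Qed.

End SequenceDistance.

Section VertexTree.
Variables (Gamma : sgraph) (w : Gamma).
Local Notation A := (raag Gamma).
Local Notation C := (~: [set w]).
Local Notation E := (link w).
Implicit Types (c g h k : A) (e : bool) (s t : seq (A * bool)).

Let parEC c : par E c -> par C c.
Proof. exact/parS/link_sub. Qed.

(** A choice of representatives of the left cosets of E. That of E is 1, so that
the cancellation of w^e c w^-e, for c in E, is visible on the representative of
the coset of c. *)
Lemma section_exists : {r : A -> A | [/\ forall c, par E (c^-1 * r c),
  forall c1 c2, par E (c1^-1 * c2) -> r c1 = r c2 & r 1 = 1]}.
Proof.
pose r0 c : A := choose (fun x => `[< par E (c^-1 * x) >]) c.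
have r0P c : par E (c^-1 * r0 c).
  apply/asboolP; apply: (@chooseP _ (fun x => `[< par E (c^-1 * x) >])).
  by apply/asboolP; rewrite mulVg; apply: par1.
exists (fun c => r0 c * (r0 1)^-1); split=> [c|c1 c2 c12|].
- rewrite mulgA; apply: parM; first exact: r0P.
  by apply: parV; have := r0P 1; rewrite invg1 mul1g.
- congr (_ * _); rewrite /r0.
  rewrite (@eq_choose _ _ (fun x => `[< par E (c2^-1 * x) >])); last first.
    move=> x; apply/asboolP/asboolP => H.
      by have := parM (parV c12) H; rewrite invgM invgK mulgA mulgK.
    by have := parM c12 H; rewrite mulgA mulgK.
  apply: choose_id; apply/asboolP; last by rewrite mulVg; apply: par1.
  by have /parV := c12; rewrite invgM invgK.
by rewrite mulgV.
Qed.

Definition rep : A -> A := sval section_exists.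

Lemma repP c : par E (c^-1 * rep c).
Proof. by rewrite /rep; case: section_exists => r []. Qed.

Lemma repPV c : par E ((rep c)^-1 * c).
Proof. by have /parV := repP c; rewrite invgM invgK. Qed.

Lemma rep_eq c1 c2 : par E (c1^-1 * c2) -> rep c1 = rep c2.
Proof. by rewrite /rep; case: section_exists => r [? H ?]; apply: H. Qed.

Lemma rep1 : rep 1 = 1.
Proof. by rewrite /rep; case: section_exists => r []. Qed.

Lemma rep_id c : rep (rep c) = rep c.
Proof. exact/rep_eq/repPV. Qed.

Lemma rep_eq1 c : rep c = 1 -> par E c.
Proof. by move=> c1; have := repPV c; rewrite c1 invg1 mul1g. Qed.

Lemma rep_par c : par E c -> rep c = 1.
Proof.
by move=> Ec; rewrite -rep1; apply: rep_eq; rewrite mulg1; apply: parV.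
Qed.

Lemma par_rep c : par C c -> par C (rep c).
Proof.
by move=> Cc; rewrite -[rep c](mulVKg c); apply: parM (parEC (repP c)).
Qed.

(** Normal forms of the HNN extension with base C, associated subgroup E and
stable letter w: a pair (c, true) stands for c w, a pair (c, false) for c w^-1,
the coefficients are coset representatives and there is no cancellation. These
sequences are the vertices of the Bass-Serre tree, each one being joined to
the sequence without its last entry. *)
Fixpoint reduced s : Prop :=
  if s is (c, e) :: s' then
    [/\ par C c, rep c = c,
        (if s' is (c', e') :: _ then c' = 1 -> e' = e else True) & reduced s']
  else True.

Fixpoint base_act c s : seq (A * bool) :=
  if s is (c1, e) :: s' then
    (rep (c * c1), e) :: base_act ((rep (c * c1))^-1 * (c * c1)) s'
  else [::].

Definition cancels e s : bool :=
  if s is (c, e') :: _ then (c == 1) && (e' == ~~ e) else false.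

Definition stable_act e s : seq (A * bool) :=
  if s is (c, e') :: s' then
    if (c == 1) && (e' == ~~ e) then s' else (1, e) :: s
  else [:: (1, e)].

Lemma base_act_reduced c s : par C c -> reduced s -> reduced (base_act c s).
Proof.
elim: s c => [|[c1 e] s IHs] c Cc //= [Cc1 _ s1 sr].
have Er := repPV (c * c1).
split; [exact/par_rep/parM|exact: rep_id| |exact/IHs/sr/parEC].
case: s s1 sr {IHs} => [|[c2 e2] s] //= c2e [_ c2r _ _] /rep_eq1 Ec2.
apply: c2e; rewrite -c2r; apply: rep_par.
by have := parM (parV Er) Ec2; rewrite mulKg.
Qed.

Lemma base_actM c1 c2 s : base_act (c1 * c2) s = base_act c1 (base_act c2 s).
Proof.
elim: s c1 c2 => [|[c e] s IHs] c1 c2 //=.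
have -> : rep (c1 * rep (c2 * c)) = rep (c1 * c2 * c).
  apply: rep_eq; rewrite invgM -!mulgA mulKg; exact: repPV.
rewrite -IHs; congr (_ :: base_act _ _).
by rewrite -!mulgA mulVKg.
Qed.

Lemma base_act1 s : reduced s -> base_act 1 s = s.
Proof.
elim: s => [|[c e] s IHs] //= [_ cr _ sr].
by rewrite mul1g cr mulVg IHs.
Qed.

Lemma stable_act_reduced e s : reduced s -> reduced (stable_act e s).
Proof.
case: s => [|[c e'] s] /=; first by split=> //; [apply: par1|apply: rep1].
case: eqP => [->|c1] /=; last by split=> //; [apply: par1|apply: rep1].
case: eqP => [_|e'e] sr; first by case: sr.
split=> //; [exact: par1|exact: rep1|].
by move=> _; move: e'e; case: (e); case: (e').
Qed.

Lemma stable_actK e s : reduced s -> stable_act (~~ e) (stable_act e s) = s.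
Proof.
case: s => [|[c e'] s] /=; first by rewrite eqxx negbK eqxx.
case: eqP => [->|c1] /=; last by rewrite eqxx negbK eqxx.
case: eqP => [-> [_ _ s1 sr]|_ _] /=; last by rewrite eqxx negbK eqxx.
case: s s1 {sr} => [|[c' e''] s] //=; case: eqP => //= -> ->//.
by rewrite negbK; case: (e).
Qed.

Lemma base_stable_act c e s : par E c -> reduced s ->
  stable_act e (base_act c s) = base_act c (stable_act e s).
Proof.
move=> Ec; have cons1 t : (1, e) :: base_act c t = base_act c ((1, e) :: t).
  by rewrite /= mulg1 rep_par // invg1 mul1g.
case: s => [_|[c1 e1] s [_ c1r _ _]]; first exact: (cons1 [::]).
rewrite [stable_act e ((c1, e1) :: s)]/=.
have [c11|c11] := eqVneq c1 1.
  rewrite c11 /= mulg1 rep_par // invg1 mul1g eqxx /=.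
  by case: eqP => // _; rewrite -cons1 /= mulg1 rep_par // invg1 mul1g.
rewrite andFb -cons1 /=; case: eqP => //= /rep_eq1 Ecc1.
case/eqP: c11; rewrite -c1r; apply: rep_par.
by have := parM (parV Ec) Ecc1; rewrite mulKg.
Qed.

Definition letter_act (l : Gamma * bool) s :=
  if l.1 == w then stable_act l.2 s
  else base_act (if l.2 then gen l.1 else (gen l.1)^-1) s.

Definition word_act (u : word Gamma) s := foldr letter_act s u.

Let parC_gen v (b : bool) : v != w -> par C (if b then gen v else (gen v)^-1).
Proof.
by move=> vw; case: b; [|apply: parV]; apply: par_gen; rewrite !inE vw.
Qed.

Lemma word_act_reduced u s : reduced s -> reduced (word_act u s).
Proof.
move=> sr; elim: u => [|[v b] u IHu] //=; rewrite /letter_act /=.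
case: (eqVneq v w) => [_|vw]; first exact: stable_act_reduced.
by apply: base_act_reduced => //; apply: parC_gen.
Qed.

Lemma word_act_cat u1 u2 s :
  word_act (u1 ++ u2) s = word_act u1 (word_act u2 s).
Proof. by rewrite /word_act foldr_cat. Qed.

(** Only the relations between w and its neighbours require an argument: they
hold since w commutes with the coefficients that it moves across. *)
Lemma word_act_pres_eq u1 u2 s : pres_eq (@raag_rel Gamma) u1 u2 -> reduced s ->
  word_act u1 s = word_act u2 s.
Proof.
move=> u12; elim: u12 s => {u1 u2} [//|u1 u2 _ IHu|u1 u2 u3 _ IH1 _ IH2
  |u1 u2 w1 w2 _ IHu _ IHw|x b|_ _ [u v uv]] s sr.
- by rewrite IHu.
- by rewrite IH1 // IH2.
- by rewrite !word_act_cat IHw // IHu //; apply: word_act_reduced.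
- rewrite /= /letter_act /=; case: (eqVneq x w) => _.
    by rewrite -{1}[b]negbK stable_actK.
  by rewrite -base_actM; case: b; rewrite /= ?mulgV ?mulVg base_act1.
rewrite /= /letter_act /=; case: (eqVneq u w) (eqVneq v w) => [uw|uw] [vw|vw].
- by move: uv; rewrite uw vw adj_irrefl.
- by rewrite base_stable_act //; apply: par_gen; rewrite inE -uw.
- by rewrite base_stable_act //; apply: par_gen; rewrite inE -vw adj_sym.
by rewrite -!base_actM; congr (base_act _ _); apply: gen_commute.
Qed.

Definition act g s := word_act (repr g) s.

Lemma act_pi u s :
  reduced s -> act (pres_pi (@raag_rel Gamma) u) s = word_act u s.
Proof.
by move=> sr; apply: word_act_pres_eq => //; apply/pres_piP; apply: pres_reprK.
Qed.

Lemma act_reduced g s : reduced s -> reduced (act g s).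
Proof. exact: word_act_reduced. Qed.

Lemma actM g h s : reduced s -> act (g * h) s = act g (act h s).
Proof.
by move=> sr; rewrite [g * h]/(pres_mul g h) /pres_mul act_pi // word_act_cat.
Qed.

Lemma act1 s : reduced s -> act 1 s = s.
Proof. by move=> sr; rewrite [1]/(pres_pi _ [::]) act_pi. Qed.

Lemma actK g s : reduced s -> act g^-1 (act g s) = s.
Proof. by move=> sr; rewrite -actM // mulVg act1. Qed.

Lemma act_gen v s : reduced s ->
  act (gen v) s = if v == w then stable_act true s else base_act (gen v) s.
Proof. by move=> sr; rewrite [gen v]/(pres_pi _ [:: (v, true)]) act_pi. Qed.

Lemma act_genV v s : reduced s -> act (gen v)^-1 s =
  if v == w then stable_act false s else base_act (gen v)^-1 s.
Proof.
move=> sr; have E1 : (gen v)^-1 = pres_pi (@raag_rel Gamma) [:: (v, false)].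
  by rewrite [LHS]pres_invE.
by rewrite [in LHS]E1 act_pi.
Qed.

Lemma act_base c s : par C c -> reduced s -> act c s = base_act c s.
Proof.
move=> Cc sr.
suff [_ ->] : par C c /\ forall s, reduced s -> act c s = base_act c s by [].
elim/(@par_ind _ C): Cc => [|g h [Cg IHg] [Ch IHh]|g [Cg IHg]|v vC].
- by split=> [|t tr]; [apply: par1|rewrite act1 // base_act1].
- split=> [|t tr]; first exact: parM.
  by rewrite actM // IHh // base_actM IHg //; apply: base_act_reduced.
- split=> [|t tr]; first exact: parV.
  have tr' : reduced (base_act g^-1 t) by apply/base_act_reduced/tr/parV.
  by rewrite -[in LHS](base_act1 tr) -(mulgV g) base_actM -IHg // actK.
split=> [|t tr]; first exact: par_gen.
by rewrite act_gen //; move: vC; rewrite !inE => /negPf->.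
Qed.

Definition stable e : A := if e then gen w else (gen w)^-1.

Lemma act_stable e s : reduced s -> act (stable e) s = stable_act e s.
Proof. by move=> sr; case: e; rewrite ?act_gen ?act_genV ?eqxx. Qed.

Lemma stableK e : stable e * stable (~~ e) = 1.
Proof. by case: e; rewrite /= ?mulgV ?mulVg. Qed.

Lemma hnn_ind (P : A -> Prop) :
    P 1 -> (forall c g, par C c -> P g -> P (c * g)) ->
    (forall e g, P g -> P (stable e * g)) -> forall g, P g.
Proof.
move=> P1 Pbase Pstable; apply: raag_ind => // v g Pg;
  case: (eqVneq v w) => [->|vw].
- exact: (Pstable true).
- by apply: Pbase Pg; apply: (parC_gen true).
- exact: (Pstable false).
by apply: Pbase Pg; apply: (parC_gen false).
Qed.

(** The vertex encoded by a sequence is the coset of this product modulo the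
base. *)
Definition seq_eval s : A := foldr (fun l g => l.1 * stable l.2 * g) 1 s.

Lemma seq_eval_base c s : par C c -> reduced s ->
  par C ((seq_eval (base_act c s))^-1 * (c * seq_eval s)).
Proof.
elim: s c => [|[c1 e] s IHs] c Cc /=; first by rewrite mulg1 invg1 mul1g.
case=> _ _ _ sr; have Er := repPV (c * c1).
have /IHs/(_ sr) := parEC Er; set r := rep _; set f := _ * (c * c1).
have comm : commute (stable e) f.
  apply: commute_par Er => v; rewrite inE => wv.
  by case: e; [|apply/commute_sym/commuteV/commute_sym]; apply: gen_commute.
have -> : c * (c1 * stable e * seq_eval s) = r * stable e * (f * seq_eval s).
  have move_f f' : commute (stable e) f' -> c * c1 = r * f' ->
      c * (c1 * stable e * seq_eval s) = r * stable e * (f' * seq_eval s).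
    by move=> cm cf; rewrite !mulgA cf -[r * _ * f']mulgA cm !mulgA.
  by apply: move_f => //; rewrite mulVKg.
by rewrite invgM !mulgA -[_ / _ * r * _]mulgA mulgVK.
Qed.

Lemma seq_eval_stable e s : reduced s ->
  seq_eval (stable_act e s) = stable e * seq_eval s.
Proof.
case: s => [|[c1 e1] s] /=; first by rewrite mul1g.
case: (eqVneq c1 1) => [-> _|_ _] /=; last by rewrite mul1g.
case: eqP => [->|_] /=; last by rewrite mul1g.
by rewrite mul1g mulgA stableK mul1g.
Qed.

Definition nf g := act g [::].

Lemma nf_reduced g : reduced (nf g). Proof. exact: act_reduced. Qed.

Lemma nfM g h : nf (g * h) = act g (nf h). Proof. exact: actM. Qed.

Lemma nf1 : nf 1 = [::]. Proof. exact: act1. Qed.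

Lemma nf_base c g : par C c -> nf (c * g) = base_act c (nf g).
Proof. by move=> Cc; rewrite nfM act_base //; apply: nf_reduced. Qed.

Lemma nf_stable e g : nf (stable e * g) = stable_act e (nf g).
Proof. by rewrite nfM act_stable //; apply: nf_reduced. Qed.

Lemma nf_eval g : par C ((seq_eval (nf g))^-1 * g).
Proof.
elim/hnn_ind: g => [|c g Cc IHg|e g IHg].
- by rewrite nf1 /= mulg1 invg1; apply: par1.
- rewrite nf_base //; have := parM (seq_eval_base Cc (nf_reduced g)) IHg.
  by rewrite !mulgA mulgK.
rewrite nf_stable seq_eval_stable; last exact: nf_reduced.
by rewrite invgM mulgA mulgVK.
Qed.

(** ** The distance *)

Definition tree_dist g h : nat := seq_dist (nf g) (nf h).

Lemma base_act_dist c s t : reduced s -> reduced t ->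
  seq_dist (base_act c s) (base_act c t) = seq_dist s t.
Proof.
have size_base c' u : size (base_act c' u) = size u.
  by elim: u c' => [|[? ?] u IHu] c' //=; rewrite IHu.
rewrite /seq_dist !size_base => sr tr; congr (_ - _.*2).
elim: s t c sr tr => [|[c1 e1] s IHs] [|[c2 e2] t] c //=.
move=> [_ c1r _ sr] [_ c2r _ tr].
rewrite !xpair_eqE; case: (c1 =P c2) => [->|c12].
  by rewrite eqxx /=; case: ifP => // _; rewrite IHs.
rewrite andFb; case: eqP => // r12; case: c12; rewrite -c1r -c2r.
apply: rep_eq; have := parM (repP (c * c1)) (repPV (c * c2)); rewrite r12.
by rewrite mulgA mulgK invgM mulgA mulgVK.
Qed.

Lemma stable_act_dist e s t : reduced s -> reduced t ->
  seq_dist (stable_act e s) (stable_act e t) = seq_dist s t.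
Proof.
have aux u v : reduced u -> cancels e u -> cancels e v = false ->
    seq_dist (stable_act e u) (stable_act e v) = seq_dist u v.
  case: u => [//|[c1 e1] u] [_ _ u1 _] /andP[/eqP c1E /eqP e1E] ve; subst c1 e1.
  have -> : stable_act e v = (1, e) :: v.
    by case: v ve => [|[c2 e2] v] //= ->.
  rewrite /= !eqxx /= /seq_dist /=.
  have -> : lcp u ((1, e) :: v) = 0.
    case: u u1 => [|[c2 e2] u] //= u1; rewrite xpair_eqE.
    by case: eqP => //= c21; rewrite (u1 c21); case: (e).
  case: v ve => [|[c2 e2] v] /=; first by rewrite !subn0 addnS.
  rewrite xpair_eqE [1 == c2]eq_sym [~~ e == e2]eq_sym => ->.
  by rewrite !subn0 !addnS.
move=> sr tr.
case Es : (cancels e s); case Et : (cancels e t).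
- case: s t Es Et {sr tr} => [|[c1 e1] s] [|[c2 e2] t] //=.
  move=> /[dup] E1 -> /[dup] E2 ->.
  have [/eqP-> /eqP->] := andP E1; have [/eqP-> /eqP->] := andP E2.
  by rewrite seq_dist_cons.
- exact: aux.
- by rewrite seq_distC aux // seq_distC.
have cons1 u : cancels e u = false -> stable_act e u = (1, e) :: u.
  by case: u => [|[c2 e2] v] //= ->.
by rewrite !cons1 // seq_dist_cons.
Qed.

Lemma tree_distM k g h : tree_dist (k * g) (k * h) = tree_dist g h.
Proof.
rewrite /tree_dist; elim/hnn_ind: k => [|c k Cc IHk|e k IHk].
- by rewrite !mul1g.
- by rewrite -!mulgA !(nf_base _ Cc) base_act_dist //; apply: nf_reduced.
by rewrite -!mulgA !nf_stable stable_act_dist //; apply: nf_reduced.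
Qed.

Lemma tree_dist1 g : tree_dist 1 g = size (nf g).
Proof. by rewrite /tree_dist nf1 seq_dist0s. Qed.

Lemma nf_par c : par C c -> nf c = [::].
Proof. by move=> Cc; rewrite /nf act_base. Qed.

Lemma tree_dist_eq0 g h : tree_dist g h = 0 <-> par C (g^-1 * h).
Proof.
split=> [gh|Cgh].
  have := tree_distM g^-1 g h; rewrite gh mulVg tree_dist1.
  move/size0nil => nf_gh; have := nf_eval (g^-1 * h).
  by rewrite nf_gh /= invg1 mul1g.
by rewrite -(tree_distM g^-1) mulVg tree_dist1 nf_par.
Qed.

Lemma nf_cons g c e s : nf g = (c, e) :: s ->
  [/\ par C c, rep c = c, nf (c * stable e) = [:: (c, e)] & reduced s].
Proof.
move=> gE; have := nf_reduced g; rewrite gE => -[Cc rc _ sr]; split=> //.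
by rewrite nf_base // -[stable e]mulg1 nf_stable nf1 /= mulg1 rc.
Qed.

Lemma vertex_tree_metric : tree_metric tree_dist.
Proof.
split=> [k x y|x|x y|x y z t|x y n xy].
- exact: tree_distM.
- exact: seq_dist_xx.
- exact: seq_distC.
- exact: seq_dist_four.
have := tree_distM x^-1 x y; rewrite xy mulVg tree_dist1.
case E1 : (nf _) => [//|[c e] s] /= [sn].
have [Cc rc nfc _] := nf_cons E1.
exists (x * (c * stable e)); split.
  by rewrite -{1}[x]mulg1 tree_distM tree_dist1 nfc.
rewrite -(tree_distM x^-1) mulKg /tree_dist E1 nfc seq_dist_cons seq_dist0s //.
Qed.

(** Here g^-1 h is a product of w or its inverse with elements of the base. In
particular no element of zero exponent sum moves a vertex to a neighbour. *)
Lemma tree_dist_expsum g h : tree_dist g h = 1%N -> expsum w (g^-1 * h) <> 0%R.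
Proof.
rewrite -(tree_distM g^-1) mulVg tree_dist1.
case E1 : (nf _) => [//|[c e] [|//]] _.
have [Cc _ _ _] := nf_cons E1.
have wC : w \notin C by rewrite !inE eqxx.
have := par_expsum (nf_eval (g^-1 * h)) wC; rewrite E1 /= mulg1.
rewrite expsumM expsumV [expsum w (c * _)]expsumM (par_expsum Cc wC) => + gh0.
by rewrite gh0; case: (e); rewrite /stable ?expsumV expsum_genE eqxx.
Qed.

(** The stabiliser of the base vertex and of another one fixes the first edge of
the geodesic between them. *)
Lemma two_vertices_stabilizer (t : A) : ~ par C t -> exists2 c, par C c &
  forall k, par C k -> tree_dist t (k * t) = 0 -> par E (c^-1 * k * c).
Proof.
move=> nCt; case E1 : (nf t) => [|[c e] s].
  by case: nCt; have := nf_eval t; rewrite E1 /= invg1 mul1g.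
have [Cc rc _ _] := nf_cons E1.
exists c => // k Ck /seq_dist0; rewrite nf_base // E1 /= => -[ck _].
by have := repPV (k * c); rewrite -ck mulgA.
Qed.

End VertexTree.

(** * Automorphisms acting trivially on homology *)

Section Automorphisms.
Variable G : groupType.
Implicit Types (f : Aut G) (g h : G).

Lemma aut_mulE f1 f2 g : (f1 * f2) g = f1 (f2 g).
Proof. by []. Qed.

Lemma autK f g : f^-1 (f g) = g. Proof. exact: aut_invK. Qed.

Lemma autVK f g : f (f^-1 g) = g. Proof. exact: autK_inv. Qed.

Lemma autV f g : f g^-1 = (f g)^-1. Proof. exact: homV (autM f) g. Qed.

Lemma aut1 f : f 1 = 1. Proof. exact: hom1 (autM f). Qed.

Lemma autJ f g h : f (g ^ h) = f g ^ f h.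
Proof. by rewrite /conjg !autM autV. Qed.

Lemma aut_commute f g h : commute g h -> commute (f g) (f h).
Proof. by move=> gh; rewrite /commute -!autM gh. Qed.

Lemma inner_conj h g : inner h^-1 g = g ^ h.
Proof. by rewrite /= invgK /conjg mulgA. Qed.

Lemma conj_commute g h : commute g h -> g ^ h = g.
Proof. by move=> gh; rewrite /conjg gh mulKg. Qed.

End Automorphisms.

Section FixedVertices.
Variable Gamma : sgraph.
Local Notation A := (raag Gamma).
Implicit Types (u v w x y z : Gamma) (g h k : A).

Lemma par_conj (S : {set Gamma}) g h : par S g -> par S h -> par S (g ^ h).
Proof. by move=> Sg Sh; apply: parM; [apply: parV|apply: parM]. Qed.

Lemma expsum_conj x g h : expsum x (g ^ h) = expsum x g.
Proof. by rewrite /conjg !expsumM expsumV addrCA addNr addr0. Qed.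

(** The vertices of the Bass-Serre tree of w are the left cosets of the base: g
fixes that of h when its conjugate by h lies in the base. *)
Definition fixes w g h : Prop := par (~: [set w]) (g ^ h).

Lemma fixesP w g h : fixes w g h <-> tree_dist w h (g * h) = 0.
Proof. by rewrite tree_dist_eq0. Qed.

(** An element fixing two vertices fixes an edge, hence lies in a conjugate of
the special subgroup of lk w. *)
Lemma fixes_unique w x g h k : expsum x g <> 0%R -> x \notin link w ->
  fixes w g h -> fixes w g k -> par (~: [set w]) (h^-1 * k).
Proof.
move=> gx xw gh gk; apply: contrapT => nC.
have [c _ H] := two_vertices_stabilizer nC.
have /(H _ gh) Ec : tree_dist w (h^-1 * k) ((g ^ h) * (h^-1 * k)) = 0.
  by apply/fixesP; rewrite /fixes -conjgM mulVKg.
case: gx; rewrite -(expsum_conj x g h) -(expsum_conj x (g ^ h) c).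
by apply: par_expsum xw; rewrite /conjg mulgA.
Qed.

Lemma fixes_commute w x g k h : expsum x g <> 0%R -> x \notin link w ->
  commute g k -> fixes w g h -> fixes w k h.
Proof.
move=> gx xw gk gh; have := @fixes_unique w x g h (k * h) gx xw gh.
by apply; rewrite /fixes conjgM (conj_commute gk).
Qed.

Lemma fixes_gen w v : v != w -> fixes w (gen v) 1.
Proof. by move=> vw; rewrite /fixes conjg1; apply: par_gen; rewrite !inE. Qed.

(** The centraliser of a generator: a generator v outside the star of w fixes a
single vertex of the tree of w, which the centraliser of v has to fix too. *)
Lemma centralizer_gen v g : commute (gen v) g -> par (star v) g.
Proof.
move=> vg; apply: par_all => w; rewrite !inE negb_or => /andP[wv nvw].
suff: fixes w g 1 by rewrite /fixes conjg1.
apply: (fixes_commute (x := v) _ _ vg).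
- by rewrite expsum_genE eqxx.
- by rewrite inE adj_sym.
by apply: fixes_gen; rewrite eq_sym.
Qed.

(** If a had no fixed vertex, two commuting elements a and b would act on the
axis of a by translations, so some b^i z, with z centralising a and b and i > 0,
would fix an edge; its exponent sum in u forbids this. *)
Lemma commuting_elliptic w u a b : commute a b -> expsum w a = 0%R ->
  expsum u a = 0%R -> expsum u b <> 0%R -> u \notin link w ->
  exists h, fixes w a h.
Proof.
move=> ab wa ua ub uw; apply: contrapT => nofix.
pose Z (z : A) := [/\ commute a z, commute b z & expsum u z = 0%R].
have a_hyp (x : A) : (1 < tree_dist w x (a * x))%N.
  have : tree_dist w x (a * x) <> 0.
    by move=> /fixesP ax; apply: nofix; exists x.
  have : tree_dist w x (a * x) <> 1%N.
    by move/tree_dist_expsum; rewrite -[_ * _]/(a ^ x) expsum_conj.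
  by case: tree_dist => [|[|n]].
have [|||||i [z [x [i0 [az bz uz] bx]]]] :=
  tm_commuting_fix (vertex_tree_metric w) (Z := Z) _ _ _ _ _ ab a_hyp.
- move=> y1 y2 [a1 b1 u1] [a2 b2 u2]; split; try exact: commuteM.
  by rewrite expsumM u1 u2.
- by move=> y [ay bY uy]; split; try exact: commuteV; rewrite expsumV uy oppr0.
- by split=> //; exact: commute_sym.
- by move=> y [].
- by move=> y [].
have fix_x : fixes w (b ^+ i * z) x.
  by apply/fixesP; rewrite -[RHS]bx; apply/tm_sym/vertex_tree_metric.
apply: nofix; exists x.
apply: (fixes_commute (x := u) (g := b ^+ i * z)) => //.
  rewrite expsumM expsumX uz addr0 => /eqP; rewrite mulrn_eq0.
  case/orP=> [/eqP i00|/eqP//].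
  by rewrite i00 in i0.
apply/commute_sym/commuteM => //; exact: commuteX.
Qed.

(** The Torelli group: the kernel of the action on homology. *)
Definition torelli (f : Aut A) : Prop :=
  forall x g, expsum x (f g) = expsum x g.

Lemma torelliV f : torelli f -> torelli f^-1.
Proof. by move=> ft x g; rewrite -ft autVK. Qed.

Lemma torelli_inner h f : torelli f -> torelli (inner h * f).
Proof. by move=> ft x g; rewrite aut_mulE /= expsumJ ft. Qed.

Definition preserves (S : {set Gamma}) (f : Aut A) : Prop :=
  (forall g, par S g -> par S (f g)) /\ (forall g, par S g -> par S (f^-1 g)).

Lemma preservesM S f1 f2 :
  preserves S f1 -> preserves S f2 -> preserves S (f1 * f2).
Proof.
move=> [f1S f1VS] [f2S f2VS]; split=> g Sg; first exact/f1S/f2S.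
by rewrite invgM; apply/f2VS/f1VS.
Qed.

Lemma preserves_inner S h : par S h -> preserves S (inner h).
Proof.
move=> Sh; split=> g Sg; rewrite -?innerV /=; do !apply: parM => //.
- exact: parV.
- exact: parV.
exact/parV/parV.
Qed.

End FixedVertices.

Section Torelli.
Variable Gamma : sgraph.
Hypotheses (Gamma_austere : austere Gamma) (card_Gamma : (1 < #|Gamma|)%N).
Local Notation A := (raag Gamma).
Implicit Types (u v w x y z : Gamma) (g h k : A) (f : Aut A).

Lemma star_sym u v : (u \in star v) = (v \in star u).
Proof. by rewrite !inE eq_sym adj_sym. Qed.

Lemma undominated u v : u != v -> exists2 x, x \in link v & x \notin star u.
Proof.
move=> uv; have /subsetPn[x xv xu] := austere_dom Gamma_austere uv.
by exists x.
Qed.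

Lemma far_vertex w : exists x, x \notin star w.
Proof.
have [v vw] : exists v, v != w.
  have : (0 < #|[set~ w]|)%N by rewrite cardsC1 -subn1 subn_gt0.
  by case/card_gt0P => v; rewrite !inE; exists v.
have [|x _ xw] := @undominated w v; first by rewrite eq_sym.
by exists x.
Qed.

Lemma notin_star_link w x : x \notin star w -> x \notin link w.
Proof. by rewrite !inE negb_or => /andP[]. Qed.

Lemma torelli_gen f v : torelli f -> expsum v (f (gen v)) <> 0%R.
Proof. by move=> ->; rewrite expsum_genE eqxx. Qed.

Lemma torelli_elliptic f v w : torelli f -> v != w ->
  exists h, fixes w (f (gen v)) h.
Proof.
move=> ft vw; have [|u uv uw] := @undominated w v; first by rewrite eq_sym.
apply: (@commuting_elliptic _ w u _ (f (gen u))).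
- by apply/aut_commute/gen_commute; rewrite inE in uv.
- by rewrite ft expsum_genE (negPf vw).
- rewrite ft expsum_genE; case: eqP uv => // ->.
  by rewrite inE adj_irrefl.
- exact: torelli_gen.
exact: notin_star_link.
Qed.

(** The image of a generator outside st w fixes a single vertex of the tree of
w, which is the same one for adjacent generators, hence for all of them since
they span a connected graph; images of neighbours of w commute with one of
these. *)
Lemma torelli_common_fixed f w : torelli f ->
  exists h, forall v, v != w -> fixes w (f (gen v)) h.
Proof.
move=> ft; have [x0 x0w] := far_vertex w.
have [|h x0h] := @torelli_elliptic f x0 w ft.
  by apply: contraNneq x0w => ->; rewrite !inE eqxx.
have step x v : x \notin star w -> adj x v ->
    fixes w (f (gen x)) h -> fixes w (f (gen v)) h.
  move=> xw xv; apply: (fixes_commute (x := x)).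
  - exact: torelli_gen.
  - exact: notin_star_link.
  exact/aut_commute/gen_commute.
have outside x : x \notin star w -> fixes w (f (gen x)) h.
  move=> xw.
  have inC y : y \notin star w -> y \in ~: star w by rewrite [y \in ~: _]inE.
  have := austere_conn Gamma_austere (Sub x0 (inC _ x0w) : induced (~: star w))
    (Sub x (inC _ xw)).
  case/connectP => p; set a := Sub x0 _; move=> pth lst.
  have : fixes w (f (gen (val a))) h by [].
  have -> : x = val (last a p) by rewrite -lst.
  elim: p a pth {lst} => [//|b p IHp] a /= /andP[ab pth] ha.
  apply: IHp => //; apply: (step (val a)) => //.
  have : val a \in ~: star w by exact: (valP a).
  by rewrite in_setC.
exists h => v vw; have [vst|] := boolP (v \in star w); last exact: outside.
have [|x xv xw] := @undominated w v; first by rewrite eq_sym.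
apply: (step x) => //; last exact: outside.
by move: xv; rewrite inE adj_sym.
Qed.

(** The common fixed vertex h of the images of the generators gives an inclusion
of the image of the base in its conjugate; the same applies to the inverse, and
the two vertices obtained agree because a generator outside st w fixes both. *)
Lemma torelli_preserves_base f w : torelli f ->
  exists h, preserves (~: [set w]) (inner h^-1 * f).
Proof.
move=> ft; have [h fh] := torelli_common_fixed w ft; exists h.
have base f' h' : (forall v, v != w -> fixes w (f' (gen v)) h') ->
    forall g, par (~: [set w]) g -> par (~: [set w]) (f' g ^ h').
  move=> fix_h g; elim/(@par_ind _ (~: [set w])) => [|g1 g2 P1 P2|g1 P1|v].
  - by rewrite aut1 conj1g; apply: par1.
  - by rewrite autM conjMg; apply: parM.
  - by rewrite autV conjVg; apply: parV.
  by rewrite !inE; apply: fix_h.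
have fC := base _ _ fh; split=> [g Cg|].
  by rewrite aut_mulE inner_conj; apply: fC.
set f1 := inner h^-1 * f.
have f1C g : par (~: [set w]) g -> par (~: [set w]) (f1 g).
  by move=> Cg; rewrite /f1 aut_mulE inner_conj; apply: fC.
have [k fk] := torelli_common_fixed w (torelliV (torelli_inner h^-1 ft)).
have fkC := base _ _ fk.
have [x0 x0w] := far_vertex w.
have x0C : par (~: [set w]) (gen x0).
  apply: par_gen; rewrite !inE; apply: contraNneq x0w => ->.
  by rewrite !inE eqxx.
(* The vertices 1 and k are fixed by the same generator, so they coincide. *)
have Ck : par (~: [set w]) k.
  rewrite -[k]mul1g -invg1.
  apply: (fixes_unique (x := x0) (g := gen x0)).
  - by rewrite expsum_genE eqxx.
  - exact: notin_star_link.
  - by rewrite /fixes conjg1.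
  by rewrite /fixes -[gen x0](autK f1); apply/fkC/f1C.
move=> g Cg; rewrite -[_ g](conjgK k); apply: par_conj; first exact: fkC.
exact: parV.
Qed.

(** The image of lk w fixes the base vertex and, as it commutes with f w, also
the image of the base vertex under f w, which is a different one. *)
Lemma torelli_link f w : torelli f -> preserves (~: [set w]) f ->
  exists2 c, par (~: [set w]) c &
    forall g, par (link w) g -> par (link w) (f g ^ c).
Proof.
move=> ft [fC _].
have nC : ~ par (~: [set w]) (f (gen w)).
  move/(@par_expsum _ _ w); rewrite ft expsum_genE eqxx !inE eqxx.
  by move/(_ isT).
have [c Cc H] := two_vertices_stabilizer nC; exists c => // g Eg.
have Cg : par (~: [set w]) (f g) by apply/fC/(parS (link_sub w)).
rewrite /conjg mulgA; apply: H => //; apply/fixesP.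
rewrite /fixes conj_commute //.
exact/aut_commute/commute_sym/commute_par_link.
Qed.

(** A special subgroup is not conjugate to a proper subgroup of itself, since
on it conjugation by q agrees with conjugation by the retraction of q. *)
Lemma par_conj_surj (S : {set Gamma}) q :
    (forall g, par S g -> par S (g ^ q)) ->
  forall (y : A), par S y -> exists2 g, par S g & y = g ^ q.
Proof.
move=> Sq y Sy; have qE (g : A) : par S g -> g ^ q = g ^ ret S q.
  move=> Sg; rewrite -(Sq g Sg) /conjg !retM retV.
  by have -> : ret S g = g by [].
exists (y ^ (ret S q)^-1); first by apply: par_conj => //; apply/parV/par_ret.
rewrite qE ?conjgKV //.
by apply: par_conj => //; apply/parV/par_ret.
Qed.

(** For z other than w, some neighbour u of w lies outside st z; it commutes
with f w and fixes only the base vertex of the tree of z, so f w fixes it too.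
Hence f w lies in the special subgroup of w. *)
Lemma torelli_fixes_gen f w : torelli f -> preserves (~: [set w]) f ->
  preserves (link w) f -> f (gen w) = gen w.
Proof.
move=> ft fC [_ fVE]; apply: par_set1; last by rewrite ft expsum_genE eqxx.
apply: par_all => z; rewrite inE => zw.
have [u uw uz] := undominated zw.
suff: fixes z (f (gen w)) 1 by rewrite /fixes conjg1.
apply: (fixes_commute (x := u) (g := gen u)).
- by rewrite expsum_genE eqxx.
- exact: notin_star_link.
- rewrite -[gen u](autVK f); apply/aut_commute/commute_sym/commute_par_link.
  exact/fVE/par_gen.
by apply: fixes_gen; apply: contraNneq uz => ->; rewrite !inE eqxx.
Qed.

Lemma torelli_normalize f w : torelli f -> exists h,
  preserves (~: [set w]) (inner h^-1 * f) /\ (inner h^-1 * f) (gen w) = gen w.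
Proof.
move=> ft; have [h] := torelli_preserves_base w ft.
set f1 := inner h^-1 * f => f1C.
have f1t : torelli f1 by apply: torelli_inner.
have [c Cc f1E] := torelli_link f1t f1C.
exists (h * c); rewrite invgM innerM -mulgA -/f1.
set f2 := inner c^-1 * f1.
have f2C : preserves (~: [set w]) f2.
  by apply: preservesM => //; apply/preserves_inner/parV.
have f2t : torelli f2 by apply: torelli_inner.
have f2E g : par (link w) g -> par (link w) (f2 g).
  by move=> Eg; rewrite /f2 aut_mulE inner_conj; apply: f1E.
have f2VC : preserves (~: [set w]) f2^-1.
  by have [H1 H2] := f2C; split=> //; rewrite invgK.
have [c' _ f2VE] := torelli_link (torelliV f2t) f2VC.
split=> //; apply: torelli_fixes_gen => //; split=> // g Eg.
have [||k Ek ->] := @par_conj_surj (link w) (f2 c') _ g => //.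
  by move=> k Ek; rewrite -[k](autVK f2) -autJ; apply/f2E/f2VE.
by rewrite autJ autK; apply: f2VE.
Qed.

(** One vertex z at a time, f is corrected by an inner automorphism preserving
the special subgroups already preserved: if h conjugates z to its image, and
this image lies in the special subgroup of S, the retraction of h to S does the
same, and differs from h by an element of the centraliser of z. *)
Lemma torelli_preserves_all f (s : seq Gamma) : torelli f ->
  exists h, forall w, w \in s -> preserves (~: [set w]) (inner h * f).
Proof.
move=> ft; elim: s => [|z s [h IHs]]; first by exists 1.
have [zs|zs] := boolP (z \in s).
  by exists h => w; rewrite inE => /orP[/eqP->|]; apply: IHs.
set f1 := inner h * f in IHs; have f1t : torelli f1 by apply: torelli_inner.
have [k [f2C f2z]] := torelli_normalize z f1t.
pose S := ~: [set x in s].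
have f1z : f1 (gen z) = gen z ^ k^-1.
  by have := congr1 (fun g => g ^ k^-1) f2z; rewrite aut_mulE inner_conj conjgK.
have Sf1z : par S (f1 (gen z)).
  apply: par_all => v; rewrite !inE negbK => vs; apply: (IHs v vs).1.
  by apply: par_gen; rewrite !inE; apply: contraNneq zs => ->.
have zS : ret S (gen z) = gen z by apply: par_gen; rewrite !inE.
have comm : commute (gen z) ((ret S k)^-1 * k).
  have : gen z ^ k^-1 = gen z ^ (ret S k)^-1.
    by rewrite -f1z -Sf1z f1z /conjg !retM !retV zS.
  move/(congr1 (fun g => g ^ k)); rewrite conjgKV -conjgM => zE.
  by rewrite /commute conjgC -zE.
have Em := @par_setU1 _ z (link z) _ (subxx _) (centralizer_gen comm).
move: Em; set a := ret [set z] _; set l := ret (link z) _ => kE.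
have Sk' : par S (ret S k * a).
  apply: parM; first exact: par_ret.
  by apply: (@parS _ [set z]); [rewrite sub1set !inE|apply: par_ret].
exists ((ret S k * a)^-1 * h) => w; rewrite innerM -mulgA -/f1 inE.
case/orP=> [/eqP->|ws].
  have -> : (ret S k * a)^-1 = l * k^-1.
    have kE' : ret S k * a * l = k by rewrite -mulgA -kE mulVKg.
    by rewrite -[in RHS]kE' [(_ * l)^-1]invgM mulVKg.
  rewrite innerM -mulgA; apply: preservesM f2C; apply: preserves_inner.
  exact: parS (link_sub z) (par_ret _ _).
apply: preservesM (IHs w ws); apply/preserves_inner/parV; apply: parS Sk'.
by apply/fintype.subsetP => x; rewrite !inE; apply: contraNneq => ->.
Qed.

Lemma torelli_inner_automorphism f : torelli f -> exists h, f = inner h.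
Proof.
move=> ft; have [h hP] := torelli_preserves_all (enum Gamma) ft.
exists h^-1; rewrite innerV; apply: (@mulgI _ (inner h)); rewrite mulgV.
apply: aut_eqP; apply: raag_hom_ext => [|//|v]; first exact: autM.
have f1t : torelli (inner h * f) by apply: torelli_inner.
apply: par_set1; last by rewrite f1t expsum_genE eqxx.
apply: par_all => w; rewrite inE => wv.
apply: (hP w _).1; first by rewrite mem_enum.
by apply: par_gen; rewrite !inE eq_sym.
Qed.

End Torelli.

(** * The action on homology *)

Section Homology.
Variable Gamma : sgraph.
Local Notation A := (raag Gamma).
Implicit Types (u v w x y z : Gamma) (g h k : A) (f : Aut A) (e : {set Gamma}).

Lemma expsum_aut f x g :
  expsum x (f g) = (\sum_v expsum v g * expsum x (f (gen v)))%R.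
Proof.
have sum_gen v : (\sum_u expsum u (gen v) * expsum x (f (gen u))
    = expsum x (f (gen v)))%R.
  rewrite (bigD1 v) //= expsum_genE eqxx mul1r big1 ?addr0 // => u uv.
  by rewrite expsum_genE eq_sym (negPf uv) mul0r.
elim/raag_ind: g => [|v g IHg|v g IHg].
- by rewrite aut1 expsum1 big1 // => v _; rewrite expsum1 mul0r.
- rewrite autM expsumM IHg -(sum_gen v) -big_split.
  by apply: eq_bigr => u _; rewrite expsumM mulrDl.
rewrite autM autV expsumM expsumV IHg -(sum_gen v) -sumrN -big_split.
by apply: eq_bigr => u _; rewrite expsumM expsumV mulrDl mulNr.
Qed.

Lemma homology_mulV f v x :
  (\sum_u expsum u (f (gen v)) * expsum x (f^-1 (gen u)) = Posz (v == x))%R.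
Proof. by rewrite -expsum_aut autK expsum_genE. Qed.

(** The determinant of the action on homology is nonzero, so its expansion has a
nonzero term. *)
Lemma homology_transversal f :
  exists s : {perm Gamma}, forall v, expsum (s v) (f (gen v)) <> 0%R.
Proof.
pose n := #|Gamma|.
pose mx (f1 : Aut A) : 'M[rat]_n :=
  (\matrix_(i, j) (expsum (enum_val j) (f1 (gen (enum_val i))))%:~R)%R.
pose M := mx f; pose N := mx f^-1.
have MN : (M *m N = 1%:M)%R.
  apply/matrixP => i j; rewrite !mxE.
  transitivity ((\sum_u expsum u (f (gen (enum_val i))) *
                expsum (enum_val j) (f^-1 (gen u)))%:~R : rat)%R.
    rewrite rmorph_sum (reindex (@enum_val Gamma predT)) /=; last first.
      by apply: onW_bij; apply: enum_val_bij.
    by apply: eq_bigr => k _; rewrite !mxE rmorphM.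
  by rewrite homology_mulV (inj_eq enum_val_inj); case: (i == j).
have detM : (\det M != 0)%R.
  apply/eqP => det0; have := congr1 (fun X : 'M_n => \det X)%R MN.
  by rewrite /= det_mulmx det0 mul0r det1 => /eqP; rewrite eq_sym oner_eq0.
have [s sP] : exists s : 'S_n, (\prod_i M i (s i) != 0)%R.
  apply: contrapT => nos; move/eqP: detM; apply.
  rewrite /determinant big1 // => s _.
  have [->|?] := eqVneq (\prod_i M i (s i))%R 0%R; first by rewrite mulr0.
  by case: nos; exists s.
have s'_inj : injective (fun v => enum_val (s (enum_rank v))).
  by move=> u v /enum_val_inj/perm_inj/enum_rank_inj.
exists (perm s'_inj) => v; rewrite permE => v0.
move/prodf_neq0: sP => /(_ (enum_rank v) isT); rewrite mxE enum_rankK.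
by rewrite v0 eqxx.
Qed.

(** For a vertex w in the support of the homology class of f v, a combination of
the classes of f u, for u in st v, is determined by its coordinates in st w,
since f u commutes with f v. This is the rank argument below. *)
Definition star_matrix f v w : 'M[rat]_(#|star v|, #|star w|) :=
  (\matrix_(i, j) (expsum (enum_val j) (f (gen (enum_val i))))%:~R)%R.

Lemma star_commute u v : u \in star v -> commute (gen v) (gen u).
Proof.
rewrite !inE => /orP[/eqP->|vu]; [exact: commute_refl|exact: gen_commute].
Qed.

Section StarCombination.
Variables (f : Aut A) (v w : Gamma) (lam : 'rV[rat]_#|star v|).

Definition star_comb x : rat :=
  (\sum_i lam ord0 i * (expsum x (f (gen (enum_val i))))%:~R)%R.

Lemma star_combE (j : 'I_#|star w|) :
  (lam *m star_matrix f v w)%R ord0 j = star_comb (enum_val j).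
Proof. by rewrite mxE; apply: eq_bigr => i _; rewrite mxE. Qed.

Lemma star_comb_commute x y : nonadj x y ->
  ((expsum x (f (gen v)))%:~R * star_comb y
   = (expsum y (f (gen v)))%:~R * star_comb x)%R.
Proof.
move=> xy; rewrite /star_comb !mulr_sumr; apply: eq_bigr => i _.
rewrite mulrCA -intrM [RHS]mulrCA -intrM; congr (_ * _%:~R)%R.
rewrite (@commute_expsum _ x y _ (f (gen (enum_val i)))) 1?mulrC //.
exact/aut_commute/star_commute/enum_valP.
Qed.

Hypothesis vw : expsum w (f (gen v)) <> 0%R.

Lemma star_comb_outside y : star_comb w = 0%R -> y \notin star w ->
  star_comb y = 0%R.
Proof.
move=> w0; rewrite !inE negb_or => /andP[yw nwy].
have /star_comb_commute : nonadj w y by rewrite /nonadj eq_sym yw.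
by rewrite w0 mulr0 => /eqP; rewrite mulf_eq0 intr_eq0 => /orP[/eqP|/eqP].
Qed.

End StarCombination.

Lemma star_matrix_free f v w : expsum w (f (gen v)) <> 0%R ->
  row_free (star_matrix f v w).
Proof.
move=> vw; apply: inj_row_free => lam lam0.
have comb_in y : y \in star w -> star_comb f lam y = 0%R.
  move=> yw; rewrite -(enum_rankK_in yw yw) -star_combE lam0 mxE //.
have comb0 y : star_comb f lam y = 0%R.
  have [/comb_in//|yw] := boolP (y \in star w).
  by apply: (star_comb_outside vw) yw; apply: comb_in; rewrite !inE eqxx.
apply/rowP => i; rewrite mxE.
have : (\sum_x star_comb f lam x *
    (expsum (enum_val i) (f^-1 (gen x)))%:~R = 0)%R.
  by rewrite big1 // => x _; rewrite comb0 mul0r.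
under eq_bigr do rewrite mulr_suml.
have inner j : (\sum_x lam ord0 j * (expsum x (f (gen (enum_val j))))%:~R *
    (expsum (enum_val i) (f^-1 (gen x)))%:~R = lam ord0 j * (j == i)%:R)%R.
  under eq_bigr do rewrite -mulrA -intrM.
  rewrite -mulr_sumr -rmorph_sum homology_mulV (inj_eq enum_val_inj).
  by case: eqP.
rewrite exchange_big; under eq_bigr do rewrite inner.
by rewrite (bigD1 i) //= eqxx mulr1 big1 ?addr0 // => j /negPf->; rewrite mulr0.
Qed.

Lemma star_leq f v w :
  expsum w (f (gen v)) <> 0%R -> (#|star v| <= #|star w|)%N.
Proof. by move/star_matrix_free/eqP <-; apply: rank_leq_col. Qed.

(** If the two stars have the same size, every vector supported on st w is a
combination of the classes of the f u. A basis vector u in lk w then shows that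
the support of the class of f v lies in st u. *)
Lemma homology_support f v w u x : expsum w (f (gen v)) <> 0%R ->
  #|star v| = #|star w| -> u \in link w -> x \notin star u ->
  expsum x (f (gen v)) = 0%R.
Proof.
move=> vw vwE uw xu; have uw' : u \in star w by rewrite inE uw orbT.
have /row_fullP[B BM] : row_full (star_matrix f v w).
  by rewrite /row_full; move/eqP: (star_matrix_free vw) => ->; rewrite vwE.
pose lam := row (enum_rank_in uw' u) B.
have combE y : y \in star w -> star_comb f lam y = ((y == u)%:R)%R.
  move=> yw; rewrite -(enum_rankK_in uw' yw) -star_combE -row_mul BM.
  rewrite !mxE (enum_rankK_in uw' yw) eq_sym.
  have -> : (enum_rank_in uw' y == enum_rank_in uw' u) = (y == u) => //.
  apply/eqP/eqP => [E1|-> //].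
  by rewrite -(enum_rankK_in uw' yw) E1 enum_rankK_in.
have comb0 : star_comb f lam w = 0%R.
  rewrite combE; last by rewrite !inE eqxx.
  by case: eqP uw => // ->; rewrite inE adj_irrefl.
have combx : star_comb f lam x = 0%R.
  have [xw|xw] := boolP (x \in star w); last exact: star_comb_outside comb0 xw.
  rewrite combE //; case: eqP xu => // ->.
  by rewrite !inE eqxx.
have /(star_comb_commute f lam) : nonadj x u.
  by move: xu; rewrite !inE negb_or adj_sym.
rewrite combx mulr0 combE // eqxx mulr1 => /eqP.
by rewrite intr_eq0 => /eqP.
Qed.

Section AustereHomology.
Hypothesis Gamma_austere : austere Gamma.

(** The permutation given by homology_transversal does not decrease the size of
stars, hence preserves it; without domination, the intersection of the stars of
the neighbours of s v is reduced to s v. *)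
Lemma homology_diagonal f v x : x != v -> expsum x (f (gen v)) = 0%R.
Proof.
have [s sP] := homology_transversal f.
have star_le u := star_leq (sP u).
have star_eq u : #|star u| = #|star (s u)|.
  have : \sum_(y : Gamma) #|star (s y)| = \sum_(y : Gamma) #|star y|.
    by rewrite [RHS](reindex_perm s).
  rewrite (bigD1 u) //= [RHS](bigD1 u) //=.
  have : \sum_(i : Gamma | i != u) #|star i|
      <= \sum_(i : Gamma | i != u) #|star (s i)|.
    exact: leq_sum.
  by have := star_le u; lia.
have supp u y : y != s u -> expsum y (f (gen u)) = 0%R.
  move=> ys; have [z zs zy] := undominated Gamma_austere ys.
  by apply: (homology_support (sP u) (star_eq u) zs); rewrite star_sym.
have s_adj u y : adj u y -> adj (s u) (s y).
  move=> uy; apply: contraT => nadj; have su_y : s u != s y.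
    rewrite (inj_eq perm_inj); apply: contraTneq uy => ->.
    by rewrite adj_irrefl.
  have := @commute_expsum _ (s u) (s y) (f (gen u)) (f (gen y)).
  rewrite /nonadj su_y nadj => /(_ isT (aut_commute f (gen_commute uy))).
  rewrite [expsum (s u) (f (gen y))]supp // mul0r => /eqP.
  by rewrite mulf_eq0 => /orP[]/eqP E1; have := sP u; have := sP y; rewrite E1.
have s_adj_iter (k : nat) u y : adj u y -> adj ((s ^+ k) u) ((s ^+ k) y).
  by move=> uy; rewrite !permX; elim: k => //= k; apply: s_adj.
have : graph_automorphism s.
  split; first by exists s^-1 => y; rewrite ?permK ?permKV.
  move=> u y; apply/idP/idP; last exact: s_adj.
  (* The inverse of s is a power of s. *)
  move/(s_adj_iter (fingroup.order s).-1).
  by rewrite -fingroup.invg_expg !permK.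
by move/(austere_aut Gamma_austere) => s_id xv; apply: supp; rewrite s_id.
Qed.

Lemma homology_sign f v :
  expsum v (f (gen v)) = 1%R \/ expsum v (f (gen v)) = (-1)%R.
Proof.
have := homology_mulV f v v; rewrite eqxx (bigD1 v) //= big1 ?addr0 => [|u uv].
  move=> /(congr1 absz)/eqP; rewrite abszM muln_eq1 => /andP[/eqP + _].
  by lia.
by rewrite homology_diagonal // mul0r.
Qed.

End AustereHomology.
End Homology.

(** * Inversions and the structure of Aut(A) *)

Section Inversions.
Variable Gamma : sgraph.
Local Notation A := (raag Gamma).
Implicit Types (u v w x y z : Gamma) (g h k : A) (f : Aut A) (e : {set Gamma}).

Definition inv_gen e v : A := if v \in e then (gen v)^-1 else gen v.

Fact inv_gen_comm e u v : adj u v -> commute (inv_gen e u) (inv_gen e v).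
Proof.
move=> uv; rewrite /inv_gen; case: ifP => _; case: ifP => _.
- exact/commuteV/commute_sym/commuteV/commute_sym/gen_commute.
- exact/commute_sym/commuteV/commute_sym/gen_commute.
- exact/commuteV/gen_commute.
exact: gen_commute.
Qed.

Definition inv_fun e : A -> A := raag_lift (inv_gen e).

Lemma inv_funM e : {morph inv_fun e : g h / g * h}.
Proof. exact/raag_liftM/inv_gen_comm. Qed.

Lemma inv_fun_gen e v : inv_fun e (gen v) = inv_gen e v.
Proof. exact/raag_lift_gen/inv_gen_comm. Qed.

Lemma inv_fun_invgen e e' v :
  inv_fun e (inv_gen e' v) = if v \in e' then (inv_gen e v)^-1 else inv_gen e v.
Proof.
by rewrite {1}/inv_gen; case: ifP; rewrite ?(homV (inv_funM e)) inv_fun_gen.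
Qed.

Lemma inv_funK e : involutive (inv_fun e).
Proof.
apply: (@raag_hom_ext _ _ (inv_fun e \o inv_fun e) id) => [g h|//|v] /=.
  by rewrite !inv_funM.
rewrite inv_fun_gen inv_fun_invgen /inv_gen.
by case: (v \in e); rewrite ?invgK.
Qed.

Fact inv_subproof e : is_automorphism (inv_fun e).
Proof.
apply/asboolP; split; last exact: inv_funM.
by exists (inv_fun e); apply: inv_funK.
Qed.

Definition inversion e : Aut A := MkAut (inv_subproof e).

Lemma aut_gen_eq f1 f2 : (forall v, f1 (gen v) = f2 (gen v)) -> f1 = f2.
Proof. by move=> f12; apply: aut_eqP; apply: raag_hom_ext f12; apply: autM. Qed.

Definition symdiff e1 e2 : {set Gamma} := [set v | (v \in e1) (+) (v \in e2)].

Lemma inversionM e1 e2 :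
  inversion e1 * inversion e2 = inversion (symdiff e1 e2).
Proof.
apply: aut_gen_eq => v.
rewrite aut_mulE /= !inv_fun_gen inv_fun_invgen /inv_gen inE.
by case: (v \in e1); case: (v \in e2); rewrite /= ?invgK.
Qed.

Lemma inversion0 : inversion set0 = 1.
Proof. by apply: aut_gen_eq => v; rewrite /= inv_fun_gen /inv_gen inE. Qed.

Lemma inversionC e1 e2 : commute (inversion e1) (inversion e2).
Proof.
rewrite /commute !inversionM; congr inversion.
by apply/setP => v; rewrite !inE addbC.
Qed.

Lemma inversionK e : inversion e * inversion e = 1.
Proof. by apply: aut_eqP => g; apply: inv_funK. Qed.

Lemma inversionV e : (inversion e)^-1 = inversion e.
Proof. exact/mulg1_eq/inversionK. Qed.

Lemma inversion_conj e1 e2 :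
  inversion e1 * inversion e2 * inversion e1 = inversion e2.
Proof. by rewrite (inversionC e1) -mulgA inversionK mulg1. Qed.

Lemma aut_inner f g : f * inner g = inner (f g) * f.
Proof. by apply: aut_eqP => h; rewrite !aut_mulE /= !autM autV. Qed.

Lemma inversion_expsum e v :
  expsum v (inversion e (gen v)) = (if v \in e then -1 else 1)%R.
Proof.
rewrite /= inv_fun_gen /inv_gen.
by case: ifP; rewrite ?expsumV expsum_genE eqxx.
Qed.

Lemma torelli_aut_gen f :
  (forall v x, expsum x (f (gen v)) = expsum x (gen v)) -> torelli f.
Proof.
move=> fg x; elim/raag_ind => [|v g IHg|v g IHg]; first by rewrite aut1.
  by rewrite autM !expsumM fg IHg.
by rewrite autM autV !expsumM !expsumV fg IHg.
Qed.

Section AustereAut.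
Hypotheses (Gamma_austere : austere Gamma) (card_Gamma : (1 < #|Gamma|)%N).

(** Composing with the inversions of the vertices where f acts by -1 on homology
yields an automorphism acting trivially on homology, hence an inner one. *)
Lemma aut_decomposition f :
  exists p : A * {set Gamma}, f = inner p.1 * inversion p.2.
Proof.
pose e := [set v | expsum v (f (gen v)) == (-1)%R].
have ft : torelli (f * inversion e).
  apply: torelli_aut_gen => v x; rewrite aut_mulE /= inv_fun_gen /inv_gen inE.
  have [->|xv] := eqVneq x v.
    have [fv|fv] := homology_sign Gamma_austere f v.
      by rewrite fv /= fv expsum_genE eqxx.
    by rewrite fv eqxx autV expsumV fv expsum_genE eqxx opprK.
  have fx := homology_diagonal Gamma_austere f xv.
  rewrite expsum_genE [v == x]eq_sym (negPf xv).
  by case: ifP => _; rewrite ?autV ?expsumV fx ?oppr0.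
have [g fE] := torelli_inner_automorphism Gamma_austere card_Gamma ft.
by exists (g, e); rewrite /= -fE -mulgA inversionK mulg1.
Qed.

(** The centre is trivial: a central element commutes with every generator, so
lies in the special subgroup of every star. *)
Lemma inner_inj : injective (@inner A).
Proof.
move=> g h gh; suff: h^-1 * g = 1.
  by move/(congr1 ( *%g h)); rewrite mulVKg mulg1.
set k := _ * g; have k1 : inner k = 1 by rewrite innerM innerV gh mulVg.
have kC v : commute (gen v) k.
  have := congr1 (fun f : Aut A => f (gen v)) k1; rewrite /= => kv.
  by rewrite /commute -{1}kv mulgVK.
rewrite -(ret_set0 k); apply/esym/par_all => w _.
have [x xw] := far_vertex Gamma_austere card_Gamma w.
apply: parS (centralizer_gen (kC x)); apply/fintype.subsetP => y yx.
by rewrite !inE; apply: contraNneq xw => <-; rewrite star_sym.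
Qed.

Lemma aut_decomposition_inj g1 e1 g2 e2 :
  inner g1 * inversion e1 = inner g2 * inversion e2 -> g1 = g2 /\ e1 = e2.
Proof.
move=> E12; have e12 : e1 = e2.
  apply/setP => v; have := congr1 (fun f : Aut A => expsum v (f (gen v))) E12.
  rewrite /= -/(inversion e1 (gen v)) -/(inversion e2 (gen v)) !expsumJ.
  by rewrite !inversion_expsum; case: (v \in e1); case: (v \in e2).
split=> //; apply: inner_inj; apply: (@mulIg _ (inversion e2)).
by rewrite -{1}e12.
Qed.

Definition far w : Gamma := xchoose (far_vertex Gamma_austere card_Gamma w).

Lemma farP w : far w \notin star w.
Proof. exact: xchooseP (far_vertex Gamma_austere card_Gamma w). Qed.

(** ** Twisted automorphisms of Aut(A) *)

Section Twist.
Variable D : {set Gamma}.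

Definition twist_set v : {set Gamma} := if v \in D then [set far v] else set0.

Lemma twist_set_star u v : u \in star v -> u \notin twist_set v.
Proof.
rewrite /twist_set; case: ifP => _; rewrite !inE // => uv.
by have := farP v; apply: contraNneq => <-; rewrite !inE.
Qed.

Definition twist_gen v : Aut A := inner (gen v) * inversion (twist_set v).

Lemma inversion_inner_gen e v : v \notin e ->
  commute (inversion e) (inner (gen v)).
Proof.
by move=> /negPf ve; rewrite /commute aut_inner /= inv_fun_gen /inv_gen ve.
Qed.

Lemma inversion_inner_genV e v : v \in e ->
  inversion e * inner (gen v) = (inner (gen v))^-1 * inversion e.
Proof.
by move=> ve; rewrite aut_inner /= inv_fun_gen /inv_gen ve innerV.
Qed.

Fact twist_gen_comm u v : adj u v -> commute (twist_gen u) (twist_gen v).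
Proof.
move=> uv; have comm_uv : commute (inner (gen u)) (inner (gen v)).
  by rewrite /commute -!innerM; congr inner; apply: gen_commute.
apply: commuteM; apply/commute_sym/commuteM.
- exact: commute_sym.
- apply/commute_sym/inversion_inner_gen/twist_set_star.
  by rewrite !inE uv orbT.
- apply/inversion_inner_gen/twist_set_star.
  by rewrite !inE adj_sym uv orbT.
exact: inversionC.
Qed.

Definition twist : A -> Aut A := raag_lift twist_gen.

Lemma twistM : {morph twist : g h / g * h}.
Proof. exact/raag_liftM/twist_gen_comm. Qed.

Lemma twist_genE v : twist (gen v) = twist_gen v.
Proof. exact/raag_lift_gen/twist_gen_comm. Qed.

(** Conjugation by an inversion inverts some of the inner automorphisms of the
generators and fixes the others; since v is not inverted in the twist of v, the
same holds for their twists. *)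
Lemma twist_inversion e g :
  twist (inversion e g) = inversion e * twist g * inversion e.
Proof.
apply: (@raag_hom_ext _ _ (fun g => twist (inversion e g))
   (fun g => inversion e * twist g * inversion e)) => [h k|h k|v].
- by rewrite autM twistM.
- rewrite twistM !mulgA -[_ * inversion e * inversion e]mulgA.
  by rewrite inversionK mulg1.
rewrite [inversion e _]inv_fun_gen /inv_gen.
have vS : v \notin twist_set v by apply: twist_set_star; rewrite !inE eqxx.
case: ifP => ve; rewrite ?(homV twistM) twist_genE /twist_gen mulgA.
  rewrite inversion_inner_genV // -!mulgA [inversion e * _]mulgA inversion_conj.
  by rewrite invgM inversionV; apply/commuteV/inversion_inner_gen.
rewrite inversion_inner_gen ?ve // -!mulgA [inversion e * _]mulgA.
by rewrite inversion_conj.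
Qed.

(** Defined through the decomposition of f, which is unique. *)
Definition twisted_fun f : Aut A :=
  let p := sval (cid (aut_decomposition f)) in twist p.1 * inversion p.2.

Lemma twisted_funE g e :
  twisted_fun (inner g * inversion e) = twist g * inversion e.
Proof.
rewrite /twisted_fun; case: cid => -[g' e'] /= /aut_decomposition_inj.
by case=> -> ->.
Qed.

Lemma twisted_fun_inner g : twisted_fun (inner g) = twist g.
Proof.
by rewrite -[inner g]mulg1 -inversion0 twisted_funE inversion0 mulg1.
Qed.

Lemma twisted_fun_inversion e : twisted_fun (inversion e) = inversion e.
Proof.
rewrite -[in LHS](mul1g (inversion e)) -inner1 twisted_funE (hom1 twistM).
by rewrite mul1g.
Qed.

Lemma twisted_funM : {morph twisted_fun : f1 f2 / f1 * f2}.
Proof.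
move=> f1 f2; have [[g1 e1] ->] := aut_decomposition f1.
have [[g2 e2] ->] := aut_decomposition f2; rewrite /= !twisted_funE.
have -> : inner g1 * inversion e1 * (inner g2 * inversion e2) =
    inner (g1 * inversion e1 g2) * inversion (symdiff e1 e2).
  rewrite -inversionM innerM -!mulgA [inversion e1 * (_ * _)]mulgA aut_inner.
  by rewrite -!mulgA.
rewrite twisted_funE twistM twist_inversion -inversionM -!mulgA.
by rewrite [inversion e1 * (inversion e1 * _)]mulgA inversionK mul1g.
Qed.

Lemma twisted_funK : involutive twisted_fun.
Proof.
move=> f; have [[g e] ->] := aut_decomposition f; rewrite /= twisted_funE.
rewrite twisted_funM twisted_fun_inversion; congr (_ * _).
apply: (@raag_hom_ext _ _ (fun g => twisted_fun (twist g)) (@inner A))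
  => [h k|h k|v].
- by rewrite twistM twisted_funM.
- exact: innerM.
rewrite twist_genE twisted_funE twist_genE /twist_gen -mulgA inversionK.
by rewrite mulg1.
Qed.

Fact twisted_subproof : is_automorphism twisted_fun.
Proof.
apply/asboolP; split; last exact: twisted_funM.
by exists twisted_fun; apply: twisted_funK.
Qed.

Definition twisted : Aut (Aut A) := MkAut twisted_subproof.

End Twist.

(** The inner automorphism of v cannot be conjugate to its product with an
inversion, since only the former acts trivially on homology. *)
Lemma twisted_sub D1 D2 :
    quotient_pi (Inn (Aut A)) (twisted D1) =
      quotient_pi (Inn (Aut A)) (twisted D2) ->
  D2 \subset D1.
Proof.
move=> /quotient_piP[k _ kE]; apply/fintype.subsetP => v vD2.
apply: contraT => vD1.
have D2E : twisted D2 = twisted D1 * inner k by rewrite kE mulVKg.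
have := congr1 (fun F : Aut (Aut A) => F (inner (gen v))) D2E.
rewrite aut_mulE [inner k _]/= !autM autV /=.
rewrite -/(twisted_fun D1 _) -/(twisted_fun D2 _) !twisted_fun_inner.
rewrite !twist_genE.
rewrite /twist_gen /twist_set vD2 (negPf vD1) inversion0 mulg1.
rewrite aut_inner mulgK -[X in _ = X]mulg1 -inversion0.
by move=> /aut_decomposition_inj[_ /setP/(_ (far v))]; rewrite !inE eqxx.
Qed.

Lemma twisted_out_inj :
  injective (fun D => quotient_pi (Inn (Aut A)) (twisted D)).
Proof.
move=> D1 D2 E12; apply/eqP; rewrite eqEsubset.
by apply/andP; split; apply: twisted_sub.
Qed.

End AustereAut.
End Inversions.

Local Open Scope classical_set_scope.
Local Open Scope card_scope.

(* |Out(Aut(A_Gamma))| >= 2^n as cardinals; Out(Aut(A_Gamma)) is not assumed  *)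
(* to be finite.                                                              *)
Theorem theorem2 (Gamma : sgraph) :
  austere Gamma -> (1 < #|Gamma|)%N ->
  [set: 'I_(2 ^ #|Gamma|)] #<= [set: Out (Aut (raag Gamma))].
Proof.
move=> aG cG.
have card_sets : (2 ^ #|Gamma|)%N = #|{set Gamma}|.
  by have := card_powerset [set: Gamma]%SET; rewrite powersetT !cardsT => ->.
pose F (i : 'I_(2 ^ #|Gamma|)) : Out (Aut (raag Gamma)) :=
  quotient_pi (Inn (Aut (raag Gamma)))
    (twisted aG cG (enum_val (cast_ord card_sets i))).
have F_inj : injective F.
  by move=> i j /twisted_out_inj/enum_val_inj/cast_ord_inj.
rewrite -(card_le_eql (inj_card_eq (in2W F_inj))).
exact: subset_card_le.
Qed.
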